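(* Consider the status updating system described in the context, operating under the highest $k$ selective encoding scheme for some $k\in\{1,\dots,n\}$ with arrival rate $\lambda>0$ and codeword lengths $\ell(x_1),\dots,\ell(x_k)$. Then the long term average age at the receiver node is $$\Delta=\frac{\mathbb{E}[L^2]+\frac{2}{q_k\lambda}\mathbb{E}[L]+\frac{2}{(q_k\lambda)^2}}{2\left(\mathbb{E}[L]+\frac{1}{q_k\lambda}\right)}+\mathbb{E}[L],$$ where $q_k=\sum_{\ell=1}^k P_X(x_\ell)$, $\mathbb{E}[L]=\sum_{i=1}^k P_{X_k}(x_i)\ell(x_i)$ and $\mathbb{E}[L^2]=\sum_{i=1}^k P_{X_k}(x_i)\ell(x_i)^2$.
   Context: An information source generates status update packets whose arrival times at a transmitter node form a Poisson process of rate $\lambda>0$. Each packet carries an independent realization of a random variable $X$ taking values in $\{x_1,\dots,x_n\}$ with known pmf $P_X$, where $P_X(x_m)\ge P_X(x_j)$ for all $m\le j$; realizations are independent of the arrival process. Highest $k$ selective encoding: only realizations in $\{x_1,\dots,x_k\}$ are encoded, realization $x_i$ ($i\le k$) being assigned a binary codeword of length $\ell(x_i)$. The transmitter uses a blocking policy: packets arriving while the transmitter is busy are discarded. When an idle transmitter receives a packet whose realization is $x_i$ with $i\le k$, it transmits the codeword over an error-free channel at one bit per unit time, so the transmission (service) takes $\ell(x_i)$ time units, after which the receiver obtains the update and the transmitter becomes idle; if the realization is $x_i$ with $i>k$, the packet is discarded and the transmitter keeps waiting for the next arrival. Define $q_k=\sum_{\ell=1}^k P_X(x_\ell)$ and the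 conditional pmf $P_{X_k}(x_i)=P_X(x_i)/q_k$ for $i\le k$ and $P_{X_k}(x_i)=0$ for $i>k$. The instantaneous age at the receiver is $\Delta(t)=t-u(t)$, where $u(t)$ is the generation (arrival) time of the most recently received update, and the long term average age is $\Delta=\lim_{T\to\infty}\frac1T\int_0^T\Delta(t)\,dt$. *)

(* Defs.v *)
From HB Require Import structures.
From mathcomp Require Import all_boot all_order all_algebra.
From mathcomp Require Import all_classical all_reals all_analysis.
Set Implicit Arguments. Unset Strict Implicit. Unset Printing Implicit Defensive.
Import Order.TTheory GRing.Theory Num.Theory.
Import numFieldNormedType.Exports.
Local Open Scope classical_set_scope.
Local Open Scope ring_scope.

(* Realization x_(i+1) is represented by the index i : 'I_n (0-based);      *)
(* highest-k selective encoding encodes exactly the indices i with i < k.   *)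
(* s j : arrival (generation) time of packet j (j = 0, 1, 2, ...),          *)
(* m j : index of the realization carried by packet j.                      *)

(* the least index i >= j satisfying Q (classical choice; 0 if none) *)
Definition first_from (Q : nat -> Prop) (j : nat) : nat :=
  xget 0%N [set i | (j <= i)%N /\ Q i /\ forall i', (j <= i')%N -> (i' < i)%N -> ~ Q i'].

(* index of the r-th packet that is actually transmitted (blocking policy):
   the transmitter starts idle at time 0; an idle transmitter serves the
   first arriving packet whose realization is encoded; packets arriving
   while it is busy are discarded; non-encoded packets are discarded. *)
Fixpoint served (n k : nat) (len : 'I_n -> nat) {R : realType}
    (s : nat -> R) (m : nat -> 'I_n) (r : nat) : nat :=
  match r with
  | 0 => first_from (fun j => (m j < k)%N) 0
  | r'.+1 =>
      let a := served k len s m r' in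
      first_from (fun j => (m j < k)%N /\ s a + (len (m a))%:R <= s j) a.+1
  end.

(* time at which the r-th transmitted update is received: its transmission
   starts at its arrival and lasts len (codeword length) time units *)
Definition depart (n k : nat) (len : 'I_n -> nat) {R : realType}
    (s : nat -> R) (m : nat -> 'I_n) (r : nat) : R :=
  s (served k len s m r) + (len (m (served k len s m r)))%:R.

Definition last_received (n k : nat) (len : 'I_n -> nat) {R : realType}
    (s : nat -> R) (m : nat -> 'I_n) (t : R) : nat :=
  xget 0%N [set r | depart k len s m r <= t /\
                    forall r', depart k len s m r' <= t -> (r' <= r)%N].

(* u(t): generation time of the most recently received update; before the
   first reception we use the convention u(t) = 0 (initial update at time 0) *)
Definition u_gen (n k : nat) (len : 'I_n -> nat) {R : realType}
    (s : nat -> R) (m : nat -> 'I_n) (t : R) : R :=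
  if `[< exists r, depart k len s m r <= t >]
  then s (served k len s m (last_received k len s m t))
  else 0.

Definition age (n k : nat) (len : 'I_n -> nat) {R : realType}
    (s : nat -> R) (m : nat -> 'I_n) (t : R) : R :=
  t - u_gen k len s m t.

(* arrival times of the Poisson process from the interarrival times Y *)
Definition arrival {R : realType} {T : Type} (Y : nat -> T -> R) (w : T) (j : nat) : R :=
  \sum_(i < j.+1) Y i w.

Definition exponential_cdf {d} {T : measurableType d} {R : realType}
    (P : probability T R) (lam : R) (Y : T -> R) : Prop :=
  forall y : R, P [set w | Y w <= y] =
    (if y < 0 then 0 else 1 - expR (- (lam * y)))%:E.

(* mutual independence of the whole family {Y_j, M_j : j in nat}
   (product rule on every finite subfamily; a prefix suffices since the
   events may be taken to be the sure event) *)
Definition mutually_independent {d} {T : measurableType d} {R : realType}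
    (P : probability T R) (n : nat) (Y : nat -> T -> R) (M : nat -> T -> 'I_n) : Prop :=
  forall (N : nat) (A : nat -> set R) (B : nat -> set 'I_n),
    (forall j, measurable (A j)) ->
    P (\bigcap_(j in [set j | (j < N)%N]) ([set w | A j (Y j w)] `&` [set w | B j (M j w)]))
    = (\prod_(j < N) (fine (P [set w | A j (Y j w)]) * fine (P [set w | B j (M j w)])))%:E.

Definition q_k {R : realType} (n k : nat) (p : 'I_n -> R) : R :=
  \sum_(i < n | (i < k)%N) p i.

Definition pmf_k {R : realType} (n k : nat) (p : 'I_n -> R) (i : 'I_n) : R :=
  if (i < k)%N then p i / q_k k p else 0.

Definition EL {R : realType} (n k : nat) (p : 'I_n -> R) (len : 'I_n -> nat) : R :=
  \sum_(i < n | (i < k)%N) pmf_k k p i * (len i)%:R.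

Definition EL2 {R : realType} (n k : nat) (p : 'I_n -> R) (len : 'I_n -> nat) : R :=
  \sum_(i < n | (i < k)%N) pmf_k k p i * ((len i)%:R ^+ 2).

Definition age_formula {R : realType} (n k : nat) (p : 'I_n -> R) (len : 'I_n -> nat)
    (lam : R) : R :=
  let q := q_k k p in
  (EL2 k p len + 2 / (q * lam) * EL k p len + 2 / ((q * lam) ^+ 2))
    / (2 * (EL k p len + 1 / (q * lam))) + EL k p len.

(* Main.v *)
Require Import Defs.
From HB Require Import structures.
From mathcomp Require Import all_boot all_order all_algebra.
From mathcomp Require Import all_classical all_reals all_analysis.
From mathcomp Require Import measurable_realfun ring lra zify.
Import Order.TTheory GRing.Theory Num.Theory.
Import numFieldNormedType.Exports.
Local Open Scope classical_set_scope.
Local Open Scope ring_scope.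

(** The process is observed at packet arrivals.  Just before packet [j] the
    state is the pair [(b, l)] of the time elapsed since the last served arrival
    and the codeword length of that served packet; packet [j] is served iff it
    is encoded and [l <= b + Y j].  Between two consecutive departures the age
    is affine, so its integral up to a departure is an explicit sum over the
    served packets ([integral_age]).

    Rather than proving that the service cycles are i.i.d., we write this sum as
    [Delta * (elapsed time)], plus a sum of functions
    [phi (M j) (b j) (l j) (Y j)] that have mean zero given the past, plus a
    boundary term depending only on the current state ([area_identity]).  The
    mean-zero identities come from the exponential law: with
    [X x = max (x, 0)], the means of [X (x + Y) - X x] and
    [X (x + Y) ^ 2 - X x ^ 2] are [1 / lam] times the means of
    [1_(x + Y >= 0)] and [2 X (x + Y)].  The fourth moments of [b] are
    bounded by a contraction argument, and the averages of the martingale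
    differences vanish almost surely by the strong law for orthogonal sequences
    with bounded second moments (convergence along squares, plus a crude bound
    inside the blocks between squares). *)

(** * Pathwise description of the transmitter *)

Lemma first_from_eq (Q : nat -> Prop) (j i : nat) : (j <= i)%N -> Q i ->
  (forall i', (j <= i')%N -> (i' < i)%N -> ~ Q i') -> first_from Q j = i.
Proof.
move=> ji Qi Qmin; rewrite /first_from; apply: xget_unique => //.
move=> a [ja [Qa amin]]; apply/eqP; rewrite eqn_leq; apply/andP; split.
- by rewrite leqNgt; apply/negP => ia; exact: amin ji ia Qi.
- by rewrite leqNgt; apply/negP => ia; exact: Qmin ja ia Qa.
Qed.

(** Half-open intervals tile the time axis between successive values of [freetime]. The degenerate
    case [a = b] occurs there, because a rejected packet leaves [freetime] unchanged. *)
Lemma integral_co_antiderivative {R : realType} (f F : R -> R) (a b : R) :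
  a <= b -> continuous f -> (forall x : R, is_derive x (1 : R) F (f x)) ->
  (\int[lebesgue_measure]_(t in `[a, b[) (f t)%:E = (F b - F a)%:E)%E.
Proof.
rewrite le_eqVlt => /predU1P[->|ab] cf dF.
  by rewrite set_itvco0 integral_set0 subrr.
have cF x : F y @[y --> x] --> F x.
  by apply: differentiable_continuous; apply/derivable1_diffP; exact: ex_derive.
rewrite integral_itv_bndo_bndc; last first.
  apply/measurable_EFinP; apply: measurable_funTS.
  exact: continuous_measurable_fun.
rewrite (@continuous_FTC2 _ _ F) //.
- exact: continuous_subspaceT.
- split; first by move=> x _; exact: ex_derive.
  + exact/cvg_at_right_filter.
  + exact/cvg_at_left_filter.
- by move=> x _; rewrite derive1E; apply: derive_val.
Qed.

Lemma integral_co_affine {R : realType} (a b c : R) : a <= b ->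
  (\int[lebesgue_measure]_(t in `[a, b[) (t - c)%:E =
   (((b - c) ^+ 2 - (a - c) ^+ 2) / 2)%:E)%E.
Proof.
move=> ab; pose F (t : R) := 2^-1 * (t - c) ^+ 2.
have dF (x : R) : is_derive x (1 : R) F (x - c).
  by apply: is_derive_eq; rewrite /GRing.scale /=; field.
rewrite (integral_co_antiderivative (fun t => t - c) F _ _ ab _ dF).
  by congr _%:E; rewrite /F; field.
by move=> x; apply: cvgB; [exact: cvg_id|exact: cvg_cst].
Qed.

Section path.
Context {R : realType} {n : nat} (k : nat) (len : 'I_n -> nat).

Definition accept (b l y : R) (i : 'I_n) : bool := (i < k)%N && (l <= b + y).

Definition step (bl : R * R) (y : R) (i : 'I_n) : R * R :=
  if accept bl.1 bl.2 y i then (0, (len i)%:R) else (bl.1 + y, bl.2).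

Variables (y : nat -> R) (m : nat -> 'I_n).

(* The initial state is that of a virtual update of length 0 served at time 0,
   in accordance with [u_gen] being 0 before the first reception. *)
Fixpoint state (j : nat) : R * R :=
  if j is j'.+1 then step (state j') (y j') (m j') else (0, 0).

Definition elapsed j := (state j).1.
Definition lastlen j := (state j).2.
Definition accepted j := accept (elapsed j) (lastlen j) (y j) (m j).

Lemma elapsedS j : elapsed j.+1 = if accepted j then 0 else elapsed j + y j.
Proof. by rewrite /elapsed /= /step -/(accepted j); case: ifP. Qed.

Lemma lastlenS j :
  lastlen j.+1 = if accepted j then (len (m j))%:R else lastlen j.
Proof. by rewrite /lastlen /= /step -/(accepted j); case: ifP. Qed.

Lemma lastlen_ge0 j : 0 <= lastlen j.
Proof. by elim: j => [//|j IH]; rewrite lastlenS; case: ifP. Qed.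

Lemma lastlen_le j : lastlen j <= \sum_i (len i)%:R.
Proof.
elim: j => [|j IH]; first by rewrite sumr_ge0.
rewrite lastlenS; case: ifP => // _.
by rewrite (bigD1 (m j)) //= lerDl sumr_ge0.
Qed.

(** Off by one: packet [j] arrives at [ptime j.+1], and [ptime 0] is the time origin. *)
Definition ptime j := \sum_(i < j) y i.
(** Generation time of the last packet served among those of index below [j], or 0 if there is
    none. *)
Definition lasttime j := ptime j - elapsed j.
(** End of the service of that packet; it may lie after the arrival of packet [j]. *)
Definition freetime j := lasttime j + lastlen j.
Definition nserved j := (\sum_(i < j) accepted i)%N.
(** A sum of trapezoids: on the interval that ends with the departure of a served packet [i], the
    age rises with slope 1 from [lastlen i] to [elapsed i + y i + len (m i)]. *)
Definition area j : R := \sum_(i < j) (accepted i)%:R *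
  (((elapsed i + y i + (len (m i))%:R) ^+ 2 - lastlen i ^+ 2) / 2).

Lemma ptimeS j : ptime j.+1 = ptime j + y j.
Proof. by rewrite /ptime big_ord_recr. Qed.

Lemma nservedS j : nserved j.+1 = (nserved j + accepted j)%N.
Proof. by rewrite /nserved big_ord_recr. Qed.

Lemma lasttimeS j :
  lasttime j.+1 = if accepted j then ptime j.+1 else lasttime j.
Proof.
by rewrite /lasttime elapsedS ptimeS; case: ifP => _; [rewrite subr0|ring].
Qed.

Lemma freetimeS j :
  freetime j.+1 = if accepted j then ptime j.+1 + (len (m j))%:R else freetime j.
Proof. by rewrite /freetime lasttimeS lastlenS; case: ifP. Qed.

Lemma acceptedE j : accepted j = (m j < k)%N && (freetime j <= ptime j.+1).
Proof.
rewrite /accepted /accept; congr (_ && _).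
by rewrite /freetime /lasttime ptimeS; apply/idP/idP => h; lra.
Qed.

Hypothesis y_ge0 : forall j, 0 <= y j.

Lemma elapsed_ge0 j : 0 <= elapsed j.
Proof.
elim: j => [//|j IH]; rewrite elapsedS; case: ifP => // _.
by rewrite addr_ge0.
Qed.

(** Only a packet that is not encoded lets the elapsed time grow freely: an accepted packet resets
    it, and an encoded packet is rejected only while the transmitter is busy, that is, when the
    elapsed time is below a codeword length. The factor [(k <= m j)] makes the fourth moment
    contract. *)
Lemma elapsed_le j : elapsed j.+1 <=
  (k <= m j)%:R * elapsed j + (y j + \sum_i (len i)%:R).
Proof.
have L0 : 0 <= \sum_i (len i)%:R :> R by rewrite sumr_ge0.
have b0 := elapsed_ge0 j; have y0 := y_ge0 j; have ll := lastlen_le j.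
rewrite elapsedS; case: ifPn => [_|]; first by rewrite addr_ge0 ?mulr_ge0 ?addr_ge0.
rewrite /accepted /accept negb_and -leqNgt -ltNge => /orP[->|lt].
  by rewrite mul1r addrA lerDl.
apply: (le_trans (ltW lt)); apply: (le_trans ll).
by rewrite -[leLHS]add0r addrA lerD2r addr_ge0 ?mulr_ge0.
Qed.

Lemma freetime_le j : freetime j <= freetime j.+1.
Proof.
rewrite freetimeS; case: ifPn => // acc.
by move: acc; rewrite acceptedE => /andP[_ /le_trans]; apply; rewrite lerDl.
Qed.

Lemma freetime_homo : {homo freetime : i j / (i <= j)%N >-> i <= j}.
Proof. by apply: homo_leq => //; [exact: le_trans|exact: freetime_le]. Qed.

Lemma nserved_homo : {homo nserved : i j / (i <= j)%N}.
Proof.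
apply: homo_leq => //; first exact: leq_trans.
by move=> j; rewrite nservedS leq_addr.
Qed.

Let s (j : nat) : R := \sum_(i < j.+1) y i.

(** Reconciles the recursion [state], which looks at one packet at a time, with [served], which
    searches forward for the next acceptable packet. Since the last service the pair of [lasttime]
    and [lastlen] is frozen, so the minimality required by [first_from] is the rejection of all
    packets in between. The two disjuncts are the situations before and after the first service. *)
Lemma path_invariant j :
  [/\ nserved j = 0%N, forall i, (i < j)%N -> ~~ accepted i &
      forall i, (i <= j)%N -> lasttime i = 0 /\ lastlen i = 0] \/
  exists a c, [/\ (a < j)%N, nserved j = c.+1, served k len s m c = a,
     forall i, (a < i < j)%N -> ~~ accepted i &
     forall i, (a < i <= j)%N -> lasttime i = s a /\ lastlen i = (len (m a))%:R].
Proof.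
(* Given the invariant at [j'], an accepted packet [j'] is the one that [served] finds at rank
   [nserved j']. *)
have servedE j' : ([/\ nserved j' = 0%N, forall i, (i < j')%N -> ~~ accepted i &
      forall i, (i <= j')%N -> lasttime i = 0 /\ lastlen i = 0] \/
  exists a c, [/\ (a < j')%N, nserved j' = c.+1, served k len s m c = a,
     forall i, (a < i < j')%N -> ~~ accepted i &
     forall i, (a < i <= j')%N -> lasttime i = s a /\ lastlen i = (len (m a))%:R]) ->
  accepted j' -> served k len s m (nserved j') = j'.
  move=> [[-> rej st] acc | [a [c [aj -> eqa rej st]]] acc].
    apply: first_from_eq => //.
      by move: acc; rewrite acceptedE => /andP[].
    move=> i _ ij mi; move/negP: (rej _ ij); apply; rewrite acceptedE mi /=.
    (* Before the first service [freetime] is 0, so acceptance reduces to being encoded, as in the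
       base case of [served]. *)
    rewrite /freetime; have [-> ->] := st _ (ltnW ij).
    by rewrite addr0 sumr_ge0.
  rewrite /= eqa; apply: first_from_eq => //.
    move: acc; rewrite acceptedE /freetime.
    by have [|-> ->] := st j'; [rewrite aj leqnn|move=> /andP[]].
  move=> i ai ij [mi le].
  have /negP : ~~ accepted i by apply: rej; rewrite ai ij.
  apply; rewrite acceptedE mi /= /freetime.
  by have [|-> ->] := st i; [rewrite ai ltnW|].
elim: j => [|j IH].
  left; split => //; first by rewrite /nserved big_ord0.
  move=> i; rewrite leqn0 => /eqP ->; split => //.
  by rewrite /lasttime /ptime big_ord0 subrr.
have [acc|nacc] := boolP (accepted j).
  right; exists j, (nserved j); split => //.
  - by rewrite nservedS acc addn1.
  - exact: servedE.
  - by move=> i /andP[]; rewrite ltnS => /leq_trans h /h; rewrite ltnn.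
  - move=> i /andP[ji ij]; have -> : i = j.+1 by apply/eqP; rewrite eqn_leq ij ji.
    by rewrite lasttimeS lastlenS acc.
case: IH => [[n0 rej st]|[a [c [aj nj eqa rej st]]]].
  left; split.
  - by rewrite nservedS (negbTE nacc) addn0.
  - by move=> i; rewrite ltnS leq_eqVlt => /orP[/eqP ->|/rej].
  - move=> i; rewrite leq_eqVlt ltnS => /orP[/eqP ->|/st//].
    by rewrite lasttimeS lastlenS (negbTE nacc); exact: st.
right; exists a, c; split => //.
- by rewrite ltnS ltnW.
- by rewrite nservedS (negbTE nacc) addn0.
- move=> i /andP[ai]; rewrite ltnS leq_eqVlt => /orP[/eqP -> //|ij].
  by apply: rej; rewrite ai ij.
- move=> i /andP[ai]; rewrite leq_eqVlt ltnS => /orP[/eqP ->|ij].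
    by rewrite lasttimeS lastlenS (negbTE nacc); apply: st; rewrite aj leqnn.
  by apply: st; rewrite ai ij.
Qed.

Hypothesis freetime_unbounded : forall c : R, exists j, c < freetime j.

(** [freetime] moves only at accepted packets, so it cannot be unbounded unless services go on
    forever. *)
Lemma nserved_unbounded r : exists j, (r <= nserved j)%N.
Proof.
elim: r => [|r [j rj]]; first by exists 0%N.
have [j' jj'] := freetime_unbounded (freetime j).
have lt : (j < j')%N.
  by rewrite ltnNge; apply/negP => /freetime_homo; rewrite leNgt jj'.
exists j'; elim: j' jj' lt => // j' IH; rewrite freetimeS ltnS nservedS.
case: ifPn => [acc _ /nserved_homo jj'|_ lt jj'].
  by rewrite addn1 ltnS (leq_trans rj).
rewrite addn0; apply: IH => //; move: jj'; rewrite leq_eqVlt => /orP[/eqP jj'|//].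
by move: lt; rewrite jj' ltxx.
Qed.

Lemma inf_served r : exists2 j, accepted j & nserved j = r.
Proof.
have [j] := nserved_unbounded r.+1; elim: j => [|j IH]; first by rewrite /nserved big_ord0.
rewrite nservedS; case: (boolP (accepted j)) => [acc|_]; last by rewrite addn0.
rewrite addn1 ltnS leq_eqVlt => /orP[/eqP rj|]; [by exists j|exact: IH].
Qed.

Lemma depart_freetime j : accepted j ->
  depart k len s m (nserved j) = freetime j.+1.
Proof.
move=> acc; case: (path_invariant j.+1) => [[_ /(_ j)]|].
  by rewrite acc ltnSn => /(_ isT).
move=> [a [c [aj]]]; rewrite nservedS acc addn1 => -[<-] eqa rej st.
rewrite /depart eqa /freetime; have [|-> ->//] := st j.+1.
by rewrite aj leqnn.
Qed.

(** Every rank is attained by some accepted packet, so all departures are values of the monotone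
    sequence [freetime], and comparing times reduces to comparing indices. *)
Lemma depart_le j t r : freetime j <= t < freetime j.+1 ->
  (depart k len s m r <= t) <-> (r < nserved j)%N.
Proof.
move=> /andP[jt tj]; have [i acc <-] := inf_served r.
rewrite depart_freetime //; split=> h.
  have ij : (i < j)%N.
    rewrite ltnNge; apply/negP => ji.
    have := lt_le_trans (le_lt_trans h tj) (freetime_homo j.+1 i.+1 ji).
    by rewrite ltxx.
  apply: leq_trans (nserved_homo _ _ ij).
  by rewrite nservedS acc addn1.
have ij : (i < j)%N.
  by rewrite ltnNge; apply/negP => /nserved_homo; rewrite leqNgt h.
exact: le_trans (freetime_homo _ _ ij) jt.
Qed.

(** The updates received by time [t] are exactly the first [nserved j] ones. If there are none, the
    convention in [u_gen] agrees with the virtual update at time 0. *)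
Lemma ageE j t : freetime j <= t < freetime j.+1 ->
  age k len s m t = t - lasttime j.
Proof.
move=> jt; rewrite /age /u_gen; congr (_ - _).
case: (path_invariant j) => [[n0 rej st]|[a [c [aj nj eqa rej st]]]].
  case: asboolP => [[r /(depart_le _ _ _ jt)]|_]; first by rewrite n0.
  by have [] := st j.
case: asboolP => [_|[]]; last first.
  by exists c; apply/(depart_le _ _ _ jt); rewrite nj.
have -> : last_received k len s m t = c.
  apply: xget_unique.
    split; first by apply/(depart_le _ _ _ jt); rewrite nj.
    by move=> r /(depart_le _ _ _ jt); rewrite nj.
  move=> r [/(depart_le _ _ _ jt)]; rewrite nj ltnS => rc max.
  apply/eqP; rewrite eqn_leq rc max //.
  by apply/(depart_le _ _ _ jt); rewrite nj.
by rewrite eqa; have [|-> //] := st j; rewrite aj leqnn.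
Qed.

Lemma freetime0 : freetime 0 = 0.
Proof. by rewrite /freetime /lasttime /ptime big_ord0 /= subrr addr0. Qed.

(** Puts the increment in the form given by [integral_co_affine]; for a rejected packet both squares
    coincide. *)
Lemma areaS j : area j.+1 = area j +
  ((freetime j.+1 - lasttime j) ^+ 2 - (freetime j - lasttime j) ^+ 2) / 2.
Proof.
rewrite /area big_ord_recr /=; congr (_ + _); rewrite freetimeS.
case: ifP => acc; last by rewrite subrr mul0r mul0r.
rewrite mul1r /freetime; congr ((_ ^+ 2 - _ ^+ 2) / 2).
  by rewrite /lasttime ptimeS; ring.
by ring.
Qed.

Lemma age_ge0 j t : freetime j <= t < freetime j.+1 -> 0 <= age k len s m t.
Proof.
move=> jt; rewrite (ageE _ _ jt) subr_ge0.
case/andP: jt => /(le_trans _) + _; apply; rewrite lerDl.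
exact: lastlen_ge0.
Qed.

Lemma freetime_locate t : 0 <= t -> exists j, freetime j <= t < freetime j.+1.
Proof.
move=> t0; have ex : exists j, t < freetime j by exact: freetime_unbounded.
have [[|j] tj jmin] := ex_minnP ex; first by move: tj; rewrite freetime0 ltNge t0.
exists j; rewrite tj andbT leNgt; apply/negP => /jmin.
by rewrite ltnn.
Qed.

Let itv_freetime_split j : `[0, freetime j.+1[%classic =
  `[0, freetime j[%classic `|` `[freetime j, freetime j.+1[%classic.
Proof.
by rewrite (@itv_bndbnd_setU _ _ _ (BLeft (freetime j))) // bnd_simp
  ?freetime_le // -freetime0 freetime_homo.
Qed.

Lemma measurable_age j :
  measurable_fun (`[0, freetime j[%classic : set R) (age k len s m).
Proof.
elim: j => [|j IH].
  by rewrite freetime0 set_itvco0; exact: measurable_fun_set0.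
rewrite itv_freetime_split; apply/measurable_funU => //; split => //.
apply: (eq_measurable_fun (fun t : R => t - lasttime j)).
  by move=> t; rewrite inE /= in_itv /= => /ageE ->.
by apply: measurable_funB.
Qed.

Lemma integral_age j :
  (\int[lebesgue_measure]_(t in `[0%R, freetime j[) (age k len s m t)%:E =
   (area j)%:E)%E.
Proof.
elim: j => [|j IH].
  by rewrite freetime0 set_itvco0 integral_set0 /area big_ord0.
rewrite itv_freetime_split ge0_integral_setU //; last 3 first.
- by rewrite -itv_freetime_split; apply/measurable_EFinP; exact: measurable_age.
- move=> t; rewrite -itv_freetime_split /= in_itv /= => /andP[/freetime_locate[i]].
  by rewrite lee_fin => /age_ge0.
- apply/disj_setPS => t [] /=; rewrite !in_itv /= => /andP[_ lt] /andP[].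
  by rewrite leNgt lt.
rewrite IH areaS EFinD; congr (_ + _)%E.
rewrite -integral_co_affine ?freetime_le //; apply: eq_integral => t.
by rewrite inE /= in_itv /= => /ageE ->.
Qed.

Lemma integral_age_bounds j t : freetime j <= t < freetime j.+1 ->
  ((area j)%:E <= \int[lebesgue_measure]_(u in `[0%R, t]) (age k len s m u)%:E
    <= (area j.+1)%:E)%E.
Proof.
move=> /andP[jt tj]; rewrite -!integral_age.
have sub1 : `[0, freetime j[ `<=` `[0, t].
  by apply: subset_itvl; rewrite bnd_simp.
have sub2 : `[0, t] `<=` `[0, freetime j.+1[.
  by apply: subset_itvl; rewrite bnd_simp.
have pos x : `[0, freetime j.+1[%classic x -> (0 <= (age k len s m x)%:E)%E.
  rewrite /= in_itv /= => /andP[/freetime_locate[i]].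
  by rewrite lee_fin => /age_ge0.
have mes : measurable_fun `[0, freetime j.+1[ (fun x => (age k len s m x)%:E).
  by apply/measurable_EFinP; exact: measurable_age.
apply/andP; split; apply: ge0_subset_integral => //.
- exact: measurable_funS mes.
- by move=> x /sub2/pos.
Qed.

End path.

(** * From averages over packets to the time average *)

Lemma cvg_harmonic_ratio {R : realType} :
  (j.+1%:R / j%:R : R) @[j --> \oo] --> (1 : R).
Proof.
rewrite -cvg_shiftS /=.
have h : (1 + (j.+1%:R : R)^-1) @[j --> \oo] --> (1 : R).
  rewrite -[X in _ --> X]addr0; apply: cvgD; first exact: cvg_cst.
  exact: cvg_harmonic.
apply: cvg_trans h; apply: near_eq_cvg; near=> j.
by rewrite -[j.+2%:R]natr1 mulrDl divff ?mul1r // pnatr_eq0.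
Unshelve. all: by end_near. Qed.

(** For [T] between the values of [freetime] at [j] and [j.+1], the time average lies between
    [A j / F j.+1] and [A j.+1 / F j]. Both tend to [Delta], because [F j] grows like [j / lam] and
    [A j] like [j * Delta / lam]. *)
Lemma average_age_cvg {R : realType} {n : nat} (k : nat) (len : 'I_n -> nat)
    (y : nat -> R) (m : nat -> 'I_n) (lam Delta : R) :
  0 < lam -> (forall j, 0 <= y j) ->
  (ptime y j / j%:R) @[j --> \oo] --> lam^-1 ->
  (elapsed k len y m j / j%:R) @[j --> \oo] --> 0 ->
  (area k len y m j / j%:R) @[j --> \oo] --> Delta / lam ->
  ((fun T : R => ((T^-1)%:E * \int[lebesgue_measure]_(t in `[0%R, T])
      (age k len (fun j => \sum_(i < j.+1) y i) m t)%:E)%E)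
    @ +oo --> Delta%:E)%classic.
Proof.
move=> lam0 y0 cS cb cA.
pose F := freetime k len y m; pose A := area k len y m.
have cl : (lastlen k len y m j / j%:R) @[j --> \oo] --> (0 : R).
  rewrite -cvg_shiftS /=.
  pose B : R := \sum_(i < n) (len i)%:R.
  apply: (@squeeze_cvgr _ _ _ _ (fun=> 0) (fun j => B * (j.+1%:R)^-1)).
  - near=> j; rewrite divr_ge0 ?lastlen_ge0 //= ler_wpM2r // ?invr_ge0 //.
    exact: lastlen_le.
  - exact: cvg_cst.
  - rewrite -[X in _ --> X](mulr0 B); apply: cvgM; first exact: cvg_cst.
    exact: cvg_harmonic.
have cF : (F j / j%:R) @[j --> \oo] --> lam^-1.
  rewrite (_ : (fun j => _) = (fun j => ptime y j / j%:R -
     elapsed k len y m j / j%:R + lastlen k len y m j / j%:R)); last first.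
    by apply/funext => j; rewrite -mulrBl -mulrDl.
  rewrite -[X in _ --> X]addr0; apply: cvgD => //.
  by rewrite -[X in _ --> X]subr0; apply: cvgB.
have Fpos : \forall j \near \oo, 0 < F j.
  have : \forall j \near \oo, 0 < F j / j%:R.
    by apply: (cvgr_gt _ cF); rewrite invr_gt0.
  apply: filter_app; near=> j; case: (ltP 0 (F j)) => // Fj.
  by rewrite ltNge mulr_le0_ge0.
have FSpos : \forall j \near \oo, 0 < F j.+1.
  by case: Fpos => N _ h; exists N => // j /= Nj; apply: h; exact: leqW.
have Funb (c : R) : exists j, c < F j.
  have lam20 : lam^-1 / 2 < lam^-1 by rewrite ltr_pdivrMr // ltr_pMr ?invr_gt0 // ltr1n.
  have : \forall j \near \oo, lam^-1 / 2 < F j / j%:R by exact: (cvgr_gt _ cF).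
  (* Eventually [F j] exceeds [j / (2 * lam)]; the index is chosen so that this is already above the
     absolute value of [c]. *)
  case=> N _ /(_ (maxn N (Num.truncn (`|c| * 2 * lam)).+1)).
  set j := maxn _ _; rewrite /= leq_maxl => /(_ isT) lt.
  have j0 : (0 < j)%N by rewrite /j leq_max orbT.
  exists j; move: lt; rewrite ltr_pdivlMr ?ltr0n //; apply: le_lt_trans.
  apply: (le_trans (ler_norm c)).
  have -> (x : R) : lam^-1 / 2 * x = x / (2 * lam) by field; rewrite gt_eqF.
  rewrite ler_pdivlMr ?mulr_gt0 //.
  apply: (@le_trans _ _ ((Num.truncn (`|c| * 2 * lam)).+1%:R)).
    by apply: ltW; rewrite mulrA truncnS_gt.
  by rewrite ler_nat leq_maxr.
(* The condition [0 <= T] sits under the existential so that [choice] yields a function defined on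
   all of [R]. *)
have ex (T : R) : exists j, 0 <= T -> F j <= T < F j.+1.
  have [T0|T0] := leP 0 T; last by exists 0%N.
  by have [j] := freetime_locate k len y m Funb _ T0; exists j.
have [jj jjP] := choice ex.
have cjj : jj T @[T --> +oo] --> \oo.
  apply/cvgnyPge => N; near=> T.
  have /andP[_ lt] : F (jj T) <= T < F (jj T).+1 by apply: jjP; near: T; exact: nbhs_pinfty_ge.
  rewrite -ltnS ltnNge; apply/negP => /(freetime_homo k len y m) le.
  have : F N <= T by near: T; apply: nbhs_pinfty_ge; exact: num_real.
  by rewrite leNgt => /negP; apply; exact: lt_le_trans lt le.
have cr := @cvg_harmonic_ratio R.
(* [Delta] is rewritten in the shape of the limits of the two products below. *)
have DE1 : Delta = Delta / lam * (lam^-1)^-1 * 1^-1.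
  by rewrite invr1 mulr1 invrK divfK // gt_eqF.
have DE2 : Delta = Delta / lam * (lam^-1)^-1 * 1 by rewrite mulr1 invrK divfK // gt_eqF.
have lamV0 : lam^-1 != 0 by rewrite gt_eqF // invr_gt0.
have E1 (a f x z : R) : f != 0 -> x != 0 -> z != 0 ->
    a / x * (f / z)^-1 * (z / x)^-1 = a / f.
  by move=> f0 x0 z0; field; rewrite f0 x0 z0.
have E2 (a f x z : R) : f != 0 -> x != 0 -> z != 0 ->
    a / z * (f / x)^-1 * (z / x) = a / f.
  by move=> f0 x0 z0; field; rewrite f0 x0 z0.
have clo : (A j / F j.+1) @[j --> \oo] --> Delta.
  have h : (A j / j%:R * (F j.+1 / j.+1%:R)^-1 * (j.+1%:R / j%:R)^-1)
      @[j --> \oo] --> Delta.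
    rewrite [X in _ --> X]DE1.
    apply: cvgM; last by apply: cvgV => //; rewrite oner_eq0.
    by apply: cvgM => //; apply: cvgV => //; rewrite (cvg_shiftS (fun j => F j / j%:R)).
  apply: cvg_trans h; apply: near_eq_cvg; near=> j.
  have j0 : (j%:R : R) != 0 by rewrite pnatr_eq0 -lt0n; near: j; exact: nbhs_infty_gt.
  have j1 : (j.+1%:R : R) != 0 by rewrite pnatr_eq0.
  have Fj : F j.+1 != 0 by rewrite gt_eqF //; near: j.
  by rewrite E1.
have chi : (A j.+1 / F j) @[j --> \oo] --> Delta.
  have h : (A j.+1 / j.+1%:R * (F j / j%:R)^-1 * (j.+1%:R / j%:R))
      @[j --> \oo] --> Delta.
    rewrite [X in _ --> X]DE2.
    apply: cvgM => //; apply: cvgM; last exact: cvgV.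
    by rewrite (cvg_shiftS (fun j => A j / j%:R)).
  apply: cvg_trans h; apply: near_eq_cvg; near=> j.
  have j0 : (j%:R : R) != 0 by rewrite pnatr_eq0 -lt0n; near: j; exact: nbhs_infty_gt.
  have j1 : (j.+1%:R : R) != 0 by rewrite pnatr_eq0.
  have Fj : F j != 0 by rewrite gt_eqF //; near: j.
  by rewrite E2.
apply: (@squeeze_cvge _ _ _ _ (fun T => (A (jj T) / F (jj T).+1)%:E) _
   (fun T => (A (jj T).+1 / F (jj T))%:E)).
- near=> T.
  have T0 : 0 < T by near: T; exact: nbhs_pinfty_gt.
  have jT := jjP T (ltW T0).
  have := integral_age_bounds k len y m y0 Funb _ _ jT.
  have Fj : 0 < F (jj T) by near: T; exact: cjj Fpos.
  set I := integral _ _ _ => /andP[lo hi]; case/andP: jT => FT TF.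
  have A0 j : 0 <= A j.
    rewrite -lee_fin -(integral_age k len y m y0 Funb); apply: integral_ge0 => t.
    rewrite /= in_itv /= lee_fin => /andP[t0 _].
    have [i] := freetime_locate k len y m Funb t t0.
    exact: age_ge0.
  apply/andP; split.
    rewrite mulrC EFinM; apply: lee_pmul => //; rewrite ?lee_fin ?invr_ge0 //.
    - by rewrite ltW // (lt_trans T0).
    - by rewrite lef_pV2 ?posrE // ?ltW // (lt_trans T0).
  rewrite mulrC EFinM; apply: lee_pmul => //; rewrite ?lee_fin ?invr_ge0.
  - exact: ltW.
  - by apply: le_trans lo; rewrite lee_fin.
  - by rewrite lef_pV2 ?posrE.
- apply: (@cvg_comp _ _ _ jj (fun j => (A j / F j.+1)%:E) _ \oo _ cjj).
  by apply: cvg_EFin => //; near=> j.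
- apply: (@cvg_comp _ _ _ jj (fun j => (A j.+1 / F j)%:E) _ \oo _ cjj).
  by apply: cvg_EFin => //; near=> j.
Unshelve. all: by end_near. Qed.

(** * A strong law for orthogonal sequences *)

Section strong_law.
Context {d : measure_display} {T : measurableType d} {R : realType}.
Variable P : probability T R.
Implicit Types X : nat -> T -> R.

Lemma measurable_sqr (f : T -> R) : measurable_fun setT f ->
  measurable_fun setT (fun w => (f w ^+ 2)%:E).
Proof. by move=> mf; apply/measurable_EFinP; exact: measurable_funX. Qed.

Lemma sum_inv_sqr_le (N : nat) : \sum_(0 <= n < N) (n.+1%:R ^+ 2)^-1 <= 2 :> R.
Proof.
(* Telescoping strengthening; at [N = 0] the convention that the inverse of 0 is 0 makes it
   [0 <= 2]. *)
suff : \sum_(0 <= n < N) (n.+1%:R ^+ 2)^-1 <= 2 - N%:R^-1 :> R.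
  by move=> /le_trans; apply; rewrite lerBlDr lerDl invr_ge0.
elim: N => [|[_|N IH]]; first by rewrite big_geq // invr0; lra.
  by rewrite big_nat1 expr1n invr1; lra.
rewrite big_nat_recr //=; apply: (le_trans (lerD IH (lexx _))).
have x0 : 0 < N.+1%:R :> R by rewrite ltr0n.
rewrite -[N.+2%:R]natr1; move: (N.+1%:R : R) x0 => x x0.
rewrite -subr_ge0 (_ : _ - _ = (x * (x + 1) ^+ 2)^-1).
  by rewrite invr_ge0 mulr_ge0 ?sqr_ge0 // ltW.
by field; apply/andP; split; rewrite gt_eqF // addr_gt0.
Qed.

(** The series of squares has finite expectation, so it converges almost surely and its terms
    vanish. The sign of [C] is not assumed, hence the absolute value in the bound. *)
Lemma sqr_summable_cvg0 X (C : R) : (forall n, measurable_fun setT (X n)) ->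
  (forall n, \int[P]_w (X n w ^+ 2)%:E <= (C / n.+1%:R ^+ 2)%:E)%E ->
  {ae P, forall w, X n w @[n --> \oo] --> (0 : R)}.
Proof.
move=> mX bX; have mX2 n := measurable_sqr _ (mX n).
have X20 n w : setT w -> (0 <= (X n w ^+ 2)%:E)%E by rewrite lee_fin sqr_ge0.
pose F w := (\sum_(0 <= n <oo) (X n w ^+ 2)%:E)%E.
have F0 w : (0 <= F w)%E by apply: nneseries_ge0 => n _ _; rewrite lee_fin sqr_ge0.
have intF : P.-integrable setT F.
  apply/integrableP; split; first by apply: ge0_emeasurable_sum => // n w _ _; exact: X20.
  under eq_integral do rewrite gee0_abs //.
  rewrite integral_nneseries //.
  apply: (@le_lt_trans _ _ (2 * `|C|)%:E); last exact: ltry.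
  apply: lime_le.
    by apply: is_cvg_nneseries => n _ _; apply: integral_ge0 => w; exact: X20.
  near=> N.
  apply: (@le_trans _ _ (\sum_(0 <= n < N) (C / n.+1%:R ^+ 2)%:E)%E).
    by apply: lee_sum => n _; exact: bX.
  rewrite sumEFin lee_fin -mulr_sumr mulrC.
  apply: (@le_trans _ _ ((\sum_(0 <= n < N) (n.+1%:R ^+ 2)^-1) * `|C|)).
    by rewrite ler_wpM2l ?ler_norm // sumr_ge0.
  by rewrite ler_wpM2r // sum_inv_sqr_le.
have := integrable_ae measurableT intF.
apply: filterS => w /(_ I) Ffin.
have Flt : (\sum_(0 <= n <oo) (X n w ^+ 2)%:E < +oo)%E by rewrite ltey_eq Ffin.
have c2 : (X n w ^+ 2)%:E @[n --> \oo] --> (0 : \bar R)%E.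
  apply: (squeeze_cvge _ (cvg_cst _) (nneseries_tail_cvg Flt _)).
    near=> n; rewrite lee_fin sqr_ge0 /=.
    have := @nneseries_lim_ge R (fun n => (X n w ^+ 2)%:E) xpredT n n.+1.
    by rewrite big_nat1; apply=> i _ _; rewrite lee_fin sqr_ge0.
  by move=> n _; rewrite lee_fin sqr_ge0.
have {}c2 : X n w ^+ 2 @[n --> \oo] --> (0 : R).
  exact: (fine_cvg c2).
apply: norm_cvg0.
rewrite (_ : (fun n => _) = (fun n => Num.sqrt (X n w ^+ 2))); last first.
  by apply/funext => n; rewrite sqrtr_sqr.
rewrite -[X in _ --> X]sqrtr0.
apply: (@cvg_comp _ _ _ (fun n => X n w ^+ 2) Num.sqrt _ _ _ c2).
exact: sqrt_continuous.
Unshelve. all: by end_near. Qed.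

(** The Cauchy-Schwarz inequality against a constant sequence. *)
Lemma sqr_sum_le (N : nat) (a : nat -> R) :
  (\sum_(i < N) a i) ^+ 2 <= N%:R * \sum_(i < N) a i ^+ 2.
Proof.
elim: N => [|N IH]; first by rewrite !big_ord0 expr0n mul0r.
rewrite !big_ord_recr /= sqrrD -natr1.
have : (\sum_(i < N) a i) * a N *+ 2 <= \sum_(i < N) a i ^+ 2 + N%:R * a N ^+ 2.
  have -> : N%:R * a N ^+ 2 = \sum_(i < N) a N ^+ 2.
    by rewrite sumr_const card_ord mulr_natl.
  rewrite mulr_suml -sumrMnl -big_split /=; apply: ler_sum => i _.
  by have := sqr_ge0 (a i - a N); rewrite sqrrB; lra.
move: IH; set s := \sum_(i < N) a i; set t := \sum_(i < N) _; nra.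
Qed.

Lemma integrableM_sqr (f g : T -> R) :
  measurable_fun setT f -> measurable_fun setT g ->
  (\int[P]_w (f w ^+ 2)%:E < +oo)%E -> (\int[P]_w (g w ^+ 2)%:E < +oo)%E ->
  P.-integrable setT (fun w => (f w * g w)%:E).
Proof.
move=> mf mg f2 g2.
have sqr_int (h : T -> R) : measurable_fun setT h -> (\int[P]_w (h w ^+ 2)%:E < +oo)%E ->
    P.-integrable setT (fun w => (h w ^+ 2)%:E).
  move=> mh h2; apply/integrableP; split; first exact: measurable_sqr.
  by under eq_integral do rewrite gee0_abs ?lee_fin ?sqr_ge0 //.
apply: (le_integrable measurableT _ _
  (integrableD measurableT (sqr_int f mf f2) (sqr_int g mg g2))).
  by apply/measurable_EFinP; exact: measurable_funM.
move=> w _; rewrite -EFinD !abse_EFin lee_fin normrM [leRHS]ger0_norm ?addr_ge0 ?sqr_ge0 //.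
rewrite -[f w ^+ 2]real_normK ?num_real // -[g w ^+ 2]real_normK ?num_real //.
by have := sqr_ge0 (`|f w| - `|g w|); rewrite sqrrB; nra.
Qed.

Variables (D : nat -> T -> R) (C : R).
Hypothesis mD : forall n, measurable_fun setT (D n).
Hypothesis D2 : forall n, (\int[P]_w (D n w ^+ 2)%:E <= C%:E)%E.

Let S N w := \sum_(j < N) D j w.

Hypothesis orthD : forall N, (\int[P]_w (S N w ^+ 2)%:E < +oo)%E ->
  (\int[P]_w (S N w * D N w)%:E = 0)%E.

Let mS N : measurable_fun setT (S N).
Proof. by apply: measurable_sum => i. Qed.

(** Pythagoras. Orthogonality is assumed only when the partial sum has a finite second moment, which
    the induction hypothesis provides at each step. *)
Lemma orthogonal_sum_moment2 N : (\int[P]_w (S N w ^+ 2)%:E <= (N%:R * C)%:E)%E.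
Proof.
elim: N => [|N IH].
  rewrite mul0r integral0_eq // => w _.
  by rewrite /S big_ord0 expr0n.
have fin : (\int[P]_w (S N w ^+ 2)%:E < +oo)%E by exact: le_lt_trans IH (ltry _).
have finD : (\int[P]_w (D N w ^+ 2)%:E < +oo)%E by exact: le_lt_trans (D2 N) (ltry _).
have iSD := integrableM_sqr (S N) (D N) (mS N) (mD N) fin finD.
have iS := integrableM_sqr (S N) (S N) (mS N) (mS N) fin fin.
have iD := integrableM_sqr (D N) (D N) (mD N) (mD N) finD finD.
have -> : (\int[P]_w (S N.+1 w ^+ 2)%:E =
    \int[P]_w ((S N w * S N w)%:E + ((S N w * D N w)%:E + ((S N w * D N w)%:E +
       (D N w * D N w)%:E))))%E.
  apply: eq_integral => w _; rewrite -!EFinD; congr _%:E.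
  by rewrite /S big_ord_recr /=; ring.
rewrite integralD //; last by do 2 (apply: integrableD => //).
rewrite integralD //; last by apply: integrableD => //.
rewrite integralD // orthD // !add0e -natr1 mulrDl mul1r EFinD.
by apply: leeD; [exact: IH|exact: D2].
Qed.

(** The indices from [n ^ 2] up to, but excluding, [n.+1 ^ 2]: there are [2 n + 1] of them. *)
Let block n w := \sum_(i < n.*2.+1) `|D (n ^ 2 + i)%N w|.

Let block_moment2 n : (\int[P]_w (block n w ^+ 2)%:E <= (n.*2.+1%:R ^+ 2 * C)%:E)%E.
Proof.
have mB2 : measurable_fun setT (fun w => n.*2.+1%:R * \sum_(i < n.*2.+1) D (n ^ 2 + i)%N w ^+ 2).
  apply: measurable_funM => //; apply: measurable_sum => i.
  exact: measurable_funX.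
apply: (@le_trans _ _ (\int[P]_w (n.*2.+1%:R * \sum_(i < n.*2.+1) D (n ^ 2 + i)%N w ^+ 2)%:E)%E).
  apply: ge0_le_integral => //.
  - by move=> w _; rewrite lee_fin sqr_ge0.
  - apply: measurable_sqr; apply: measurable_sum => i.
    exact: measurableT_comp.
  - exact/measurable_EFinP.
  - move=> w _; rewrite lee_fin.
    apply: le_trans (sqr_sum_le _ (fun i => `|D (n ^ 2 + i)%N w|)) _.
    by rewrite ler_wpM2l // ler_sum // => i _; rewrite -normrX ger0_norm ?sqr_ge0.
under eq_integral do rewrite EFinM -sumEFin.
rewrite ge0_integralZl //; last 2 first.
- under eq_fun do rewrite sumEFin; apply/measurable_EFinP.
  by apply: measurable_sum => i; exact: measurable_funX.
- by move=> w _; apply: sume_ge0 => i _; rewrite lee_fin sqr_ge0.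
rewrite ge0_integral_sum //; last 2 first.
- by move=> i; exact: measurable_sqr.
- by move=> i w _; rewrite lee_fin sqr_ge0.
rewrite expr2 -mulrA EFinM; apply: lee_wpmul2l; first by rewrite lee_fin.
apply: (@le_trans _ _ (\sum_(i < n.*2.+1) C%:E)%E).
  by apply: lee_sum => i _; exact: D2.
by rewrite sumEFin sumr_const card_ord lee_fin mulr_natl.
Qed.

Lemma sum_le_block n N w : (n ^ 2 <= N)%N -> (N < n.+1 ^ 2)%N ->
  `|S N w| <= `|S (n ^ 2)%N w| + block n w.
Proof.
move=> nN Nn; rewrite -(subnKC nN) /S big_split_ord /=.
apply: (le_trans (ler_normD _ _)); rewrite lerD2l.
apply: (le_trans (ler_norm_sum _ _ _)); rewrite /block.
have le : (N - n ^ 2 <= n.*2.+1)%N.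
  by rewrite leq_subLR -addnn; move: Nn; rewrite !expnS !expn0 !muln1; lia.
rewrite -(subnKC le) big_split_ord /= lerDl; exact: sumr_ge0.
Qed.

(** Along squares the normalised sum has second moment at most [C / n ^ 2]. A block divided by
    [n ^ 2] has second moment of the same order, since its squared number of terms is of order
    [n ^ 2]. Both bounds are summable, and [sum_le_block] covers the remaining indices. *)
Lemma orthogonal_strong_law :
  {ae P, forall w, (S N w / N%:R) @[N --> \oo] --> (0 : R)}.
Proof.
have C0 : 0 <= C.
  by rewrite -lee_fin; apply: le_trans (D2 0); apply: integral_ge0 => w _; rewrite lee_fin sqr_ge0.
pose X n w := S (n.+1 ^ 2)%N w / n.+1%:R ^+ 2.
pose Z n w := block n.+1 w / n.+1%:R ^+ 2.
have mX n : measurable_fun setT (X n) by apply: measurable_funM.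
have mZ n : measurable_fun setT (Z n).
  apply: measurable_funM => //; apply: measurable_sum => i.
  exact: measurableT_comp.
have scale (f : T -> R) (n : nat) (K : R) : measurable_fun setT f ->
    (\int[P]_w (f w ^+ 2)%:E <= (n.+1%:R ^+ 2 * K)%:E)%E ->
    (\int[P]_w ((f w / n.+1%:R ^+ 2) ^+ 2)%:E <= (K / n.+1%:R ^+ 2)%:E)%E.
  move=> mf le; under eq_integral do rewrite exprMn EFinM.
  rewrite ge0_integralZr //; last 2 first.
  - exact: measurable_sqr.
  - by move=> w _; rewrite lee_fin sqr_ge0.
  apply: (@le_trans _ _ ((n.+1%:R ^+ 2 * K)%:E * ((n.+1%:R ^+ 2)^-1 ^+ 2)%:E)%E).
    by apply: lee_wpmul2r => //; rewrite lee_fin sqr_ge0.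
  have n0 : n.+1%:R != 0 :> R by rewrite pnatr_eq0.
  rewrite -EFinM lee_fin le_eqVlt; apply/orP; left; apply/eqP.
  by move: (n.+1%:R : R) n0 => x x0; field.
have cX : {ae P, forall w, X n w @[n --> \oo] --> (0 : R)}.
  apply: (sqr_summable_cvg0 X C mX) => n; apply: scale => //.
  by have := orthogonal_sum_moment2 (n.+1 ^ 2); rewrite natrX.
have cZ : {ae P, forall w, Z n w @[n --> \oo] --> (0 : R)}.
  (* The block of index [n.+1] has [2 n + 3] terms, at most three times [n.+1], whence the constant
     9. *)
  apply: (sqr_summable_cvg0 Z (9 * C) mZ) => n; apply: scale.
    by apply: measurable_sum => i; exact: measurableT_comp.
  apply: (le_trans (block_moment2 _)); rewrite lee_fin mulrA ler_wpM2r //.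
  by rewrite -!natrX -natrM ler_nat -addnn !expnS !expn0 !muln1; nia.
move: cX cZ; apply: filterS2 => w cX cZ.
apply/cvgrPdist_lt => e e0.
have e20 : 0 < e / 2 by rewrite divr_gt0.
have [K1 _ HX] := (cvgrPdist_lt _ _).1 cX _ e20.
have [K2 _ HZ] := (cvgrPdist_lt _ _).1 cZ _ e20.
pose K := maxn K1 K2.
(* Beyond this rank the integer square root of [N] exceeds [K]. *)
exists (K.+1 ^ 2)%N => // N /= KN.
have [n nN Nn] : exists2 n, (n ^ 2 <= N)%N & (N < n.+1 ^ 2)%N.
  have ex : exists n, (N < n.+1 ^ 2)%N by exists N; rewrite expnS expn1; nia.
  case: (ex_minnP ex) => -[|n] Nn min; first by exists 0%N.
  by exists n.+1 => //; rewrite leqNgt; apply/negP => /min; rewrite ltnn.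
have Kn : (K < n)%N.
  by rewrite -ltnS -(ltn_exp2r _ _ (isT : (0 < 2)%N)); exact: leq_ltn_trans KN Nn.
case: n nN Nn Kn => // n nN Nn; rewrite ltnS => Kn.
have := HX n (leq_trans (leq_maxl _ _) Kn).
have := HZ n (leq_trans (leq_maxr _ _) Kn).
rewrite /X /Z !sub0r !normrN !normrM.
have n20 : 0 < n.+1%:R ^+ 2 :> R by rewrite exprn_gt0.
have nn : n.+1%:R ^+ 2 <= N%:R :> R by rewrite -natrX ler_nat.
have N0 : 0 < N%:R :> R by exact: lt_le_trans nn.
have nV (x : R) : 0 < x -> `|x^-1| = x^-1 by move=> x0; rewrite ger0_norm ?invr_ge0 ?ltW.
rewrite !nV // [`|block _ _|]ger0_norm ?sumr_ge0 // !ltr_pdivrMr //.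
move=> hZ hX; have := sum_le_block _ _ w nN Nn; nra.
Qed.
End strong_law.

(** * Independence and the filtration of past packets *)

(** No integrability is required: the positive and negative parts are transported separately. *)
Lemma integral_pushforwardT {d1 d2 : measure_display} {X : measurableType d1}
    {Y : measurableType d2} {R : realType} (mu : {measure set X -> \bar R})
    (phi : X -> Y) (f : Y -> \bar R) :
  measurable_fun setT phi -> measurable_fun setT f ->
  (\int[pushforward mu phi]_y f y = \int[mu]_x f (phi x))%E.
Proof.
move=> mphi mf; rewrite [RHS]integralE [LHS]integralE.
have pf (g : Y -> \bar R) : measurable_fun setT g -> (forall y, 0 <= g y)%E ->
    (\int[pushforward mu phi]_y g y = \int[mu]_x g (phi x))%E.
  by move=> mg g0; rewrite ge0_integral_pushforward.
rewrite -[fun x => f (phi x)]/(f \o phi) (funepos_comp f phi) (funeneg_comp f phi).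
congr (_ - _)%E.
- exact: pf f^\+%E (measurable_funepos mf) (funepos_ge0 f).
- exact: pf f^\-%E (measurable_funeneg mf) (funeneg_ge0 f).
Qed.

Section independence.
Context {d : measure_display} {T : measurableType d} {R : realType}.
Variable P : probability T R.
Variables (G : set (set T)) (Z : T -> R).
Hypotheses (Gm : G `<=` measurable) (GT : G setT) (GI : setI_closed G).
Hypothesis mZ : measurable_fun setT Z.
Hypothesis indepZ : forall E A, G E -> measurable A ->
  P (E `&` Z @^-1` A) = (P E * P (Z @^-1` A))%E.

Lemma sub_g_sigma_algebra_measurable : <<s G >> `<=` measurable.
Proof.
by apply: smallest_sub => //; exact: sigma_algebra_measurable.
Qed.

Let mZA A : measurable A -> measurable (Z @^-1` A).
Proof. by move=> mA; rewrite -[X in measurable X]setTI; exact: mZ. Qed.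

(** With the event of [Z] fixed, both sides are finite measures in [E] that agree on the pi-system
    [G], hence on the sigma-algebra it generates. *)
Lemma indep_g_sigma_algebra E A : <<s G >> E -> measurable A ->
  P (E `&` Z @^-1` A) = (P E * P (Z @^-1` A))%E.
Proof.
move=> sGE mA; have mB := mZA _ mA.
pose r : {nonneg R} := NngNum (fine_ge0 (measure_ge0 P (Z @^-1` A))).
have rE : (r%:num%:E = P (Z @^-1` A))%E by rewrite fineK // fin_num_measure.
suff : mrestr P mB E = mscale r P E by rewrite /mrestr /mscale muleC rE.
apply: (g_sigma_algebra_measure_unique G _ (fun=> setT)) => //.
- by rewrite bigcup_const.
- by move=> F GF; rewrite /= /mrestr /mscale indepZ // muleC rE.
- by move=> _; rewrite /= /mrestr setTI -ge0_fin_numE // fin_num_measure.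
Qed.

Local Notation T' := (g_sigma_algebraType G).

(** The freezing lemma: what is known from [G] is held fixed while the independent [Z] is integrated
    out. The joint law is a product measure, so Fubini applies. *)
Lemma integral_indep (f : T -> R -> R) :
  measurable_fun setT ((fun z => f z.1 z.2) : T' * R -> R) ->
  P.-integrable setT (fun w => (f w (Z w))%:E) ->
  (\int[P]_w (f w (Z w))%:E = \int[P]_w \int[P]_w' (f w (Z w'))%:E)%E.
Proof.
move=> mf intf.
(* The identity into the coarser space turns the sub-sigma-algebra into a random variable, whose law
   is [P] restricted to it. *)
have mid : measurable_fun setT (id : T -> T').
  by move=> _ A mA; rewrite setTI preimage_id; exact: sub_g_sigma_algebra_measurable.
have mJ : measurable_fun setT ((fun w => (w, Z w)) : T -> T' * R).
  exact: measurable_fun_pair.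
pose idf : {mfun T >-> T'} := HB.pack (id : T -> T') (isMeasurableFun.Build _ _ _ _ _ mid).
pose Zf : {mfun T >-> R} := HB.pack Z (isMeasurableFun.Build _ _ _ _ _ mZ).
pose Jf : {mfun T >-> (T' * R)%type} :=
  HB.pack ((fun w => (w, Z w)) : T -> T' * R) (isMeasurableFun.Build _ _ _ _ _ mJ).
pose P1 := distribution P idf; pose P2 := distribution P Zf.
have prodE (X : set (T' * R)) : measurable X -> (P1 \x P2)%E X = distribution P Jf X.
  apply: product_measure_unique => A B mA mB.
  exact: indep_g_sigma_algebra.
pose F := (fun z => (f z.1 z.2)%:E) : T' * R -> \bar R.
have mF : measurable_fun setT F by exact/measurable_EFinP.
have intFJ : (distribution P Jf).-integrable setT F.
  exact: integrable_pushforward.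
have intF : (P1 \x P2)%E.-integrable setT F.
  apply/integrableP; split => //; have /integrableP[_] := intFJ.
  by congr (_ < _)%E; apply: eq_measure_integral => A mA _ /=; rewrite prodE.
have -> : (\int[P]_w (f w (Z w))%:E = \int[distribution P Jf]_z F z)%E.
  by rewrite integral_pushforward.
rewrite (eq_measure_integral (P1 \x P2)%E); last by move=> A mA _; exact/esym/prodE.
rewrite -integral12_prod_meas1 //.
apply: etrans (integral_pushforwardT P (id : T -> T') _ mid (measurable_fubini_F intF)) _.
apply: eq_integral => w _; apply: (integral_pushforwardT P Z (fun y => F (w, y))) => //.
exact: (measurable_fun_pair2 (w : T') mF).
Qed.
End independence.

Lemma measurable_fun_select {d d' : measure_display} {T : measurableType d}
    {U : measurableType d'} {n : nat} (M : T -> 'I_n) (f : 'I_n -> T -> U) :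
  (forall i, measurable [set w | M w = i]) ->
  (forall i, measurable_fun setT (f i)) ->
  measurable_fun setT (fun w => f (M w) w).
Proof.
move=> mM mf _ B mB; rewrite setTI.
have -> : (fun w => f (M w) w) @^-1` B =
    \bigcup_(i in [set: 'I_n]) ([set w | M w = i] `&` f i @^-1` B).
  apply/seteqP; split=> [w /= Bw|w [i _ [/= <-]]//].
  by exists (M w).
apply: fin_bigcup_measurable => // i _; apply: measurableI => //.
by rewrite -[X in measurable X]setTI; exact: mf.
Qed.

(** * Adaptedness of the state *)

Section state_measurable.
Context {d : measure_display} {T : measurableType d} {R : realType} {n : nat}.
Variables (k : nat) (len : 'I_n -> nat) (N : nat).
Variables (Y : nat -> T -> R) (M : nat -> T -> 'I_n).
Hypothesis mY : forall j, (j < N)%N -> measurable_fun setT (Y j).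
Hypothesis mM : forall j i, (j < N)%N -> measurable [set w | M j w = i].

Let b j w := elapsed k len (Y^~ w) (M^~ w) j.
Let l j w := lastlen k len (Y^~ w) (M^~ w) j.

(** The measurable structure is kept arbitrary so that it can be instantiated with the sigma-algebra
    of the first [N] packets; for that reason only packets of index below [N] are assumed
    measurable. *)
Lemma measurable_state j : (j <= N)%N ->
  measurable_fun setT (b j) /\ measurable_fun setT (l j).
Proof.
elim: j => [_|j IH jN]; first by split; exact: measurable_cst.
have [mb ml] := IH (ltnW jN).
have macc i : measurable_fun setT (fun w => accept k (b j w) (l j w) (Y j w) i).
  apply: measurable_and; first exact: measurable_cst.
  by apply: measurable_fun_ler => //; apply: measurable_funD => //; exact: mY.
split.
- rewrite (_ : b j.+1 = fun w => if accept k (b j w) (l j w) (Y j w) (M j w) then 0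
      else b j w + Y j w); last by apply/funext => w; rewrite /b elapsedS.
  apply: (measurable_fun_select (M j) (fun i w =>
    if accept k (b j w) (l j w) (Y j w) i then 0 else b j w + Y j w)) => i.
    exact: mM.
  apply: measurable_fun_ifT => //.
  by apply: measurable_funD => //; exact: mY.
- rewrite (_ : l j.+1 = fun w => if accept k (b j w) (l j w) (Y j w) (M j w)
      then (len (M j w))%:R else l j w); last by apply/funext => w; rewrite /l lastlenS.
  apply: (measurable_fun_select (M j) (fun i w =>
    if accept k (b j w) (l j w) (Y j w) i then (len i)%:R else l j w)) => i.
    exact: mM.
  exact: measurable_fun_ifT.
Qed.
End state_measurable.

Section filtration.
Context {d : measure_display} {T : measurableType d} {R : realType} {n : nat}.
Variables (P : probability T R) (Y : nat -> T -> R) (M : nat -> T -> 'I_n).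
Variable p : 'I_n -> R.
Hypothesis mY : forall j, measurable_fun setT (Y j).
Hypothesis mM : forall j i, measurable [set w | M j w = i].
Hypothesis PM : forall j i, P [set w | M j w = i] = (p i)%:E.
Hypothesis indepYM : mutually_independent P Y M.

Definition rect (A : nat -> set R) (B : nat -> set 'I_n) N : set T :=
  \bigcap_(j in [set j | (j < N)%N])
     ([set w | A j (Y j w)] `&` [set w | B j (M j w)]).

(** A pi-system generating the history of the first [N] packets. *)
Definition past N : set (set T) :=
  [set E | exists A B, (forall j, measurable (A j)) /\ E = rect A B N].

(** The same history together with the interarrival time of packet [N], but without its realization;
    this allows [M N] and [Y N] to be integrated out in turn. *)
Definition pastY N : set (set T) :=
  [set E | exists A B C, [/\ forall j, measurable (A j), measurable C &
     E = rect A B N `&` [set w | C (Y N w)]]].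

Let mYA j A : measurable A -> measurable [set w | A (Y j w)].
Proof. by move=> mA; rewrite -[X in measurable X]setTI; exact: mY. Qed.

Let mMB j (B : set 'I_n) : measurable [set w | B (M j w)].
Proof.
rewrite (_ : mkset _ = \bigcup_(i in B) [set w | M j w = i]).
  by apply: fin_bigcup_measurable => //; exact: finite_finset.
by apply/seteqP; split=> [w Bw|w [i Bi /= ->]//]; exists (M j w).
Qed.

Lemma measurable_rect A B N : (forall j, measurable (A j)) ->
  measurable (rect A B N).
Proof.
move=> mA; apply: bigcap_measurableType.
by move=> j _; apply: measurableI; [exact: mYA|exact: mMB].
Qed.

Lemma rectI A B A' B' N : rect A B N `&` rect A' B' N =
  rect (fun j => A j `&` A' j) (fun j => B j `&` B' j) N.
Proof.
apply/seteqP; split=> w.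
  by move=> [h h'] j jN; have [? ?] := h j jN; have [? ?] := h' j jN.
by move=> h; split=> j jN; have [[? ?] [? ?]] := h j jN.
Qed.

Lemma rectS A B N A' B' :
  rect A B N `&` ([set w | A' (Y N w)] `&` [set w | B' (M N w)]) =
  rect (fun j => if j == N then A' else A j) (fun j => if j == N then B' else B j) N.+1.
Proof.
apply/seteqP; split=> w.
  move=> [h [hA hB]] j /=; rewrite ltnS leq_eqVlt => /orP[/eqP ->|jN].
    by rewrite eqxx.
  by rewrite (ltn_eqF jN); exact: h.
move=> h; split; last by have := h N (ltnSn N); rewrite eqxx.
by move=> j /= jN; have := h j (ltnW jN); rewrite (ltn_eqF jN).
Qed.

Lemma P_rectS A B N A' B' : (forall j, measurable (A j)) -> measurable A' ->
  P (rect A B N `&` ([set w | A' (Y N w)] `&` [set w | B' (M N w)])) =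
  (P (rect A B N) * (P [set w | A' (Y N w)] * P [set w | B' (M N w)]))%E.
Proof.
move=> mA mA'; rewrite rectS indepYM; last by move=> j; case: ifP.
have fY : P [set w | A' (Y N w)] \is a fin_num by apply: fin_num_measure; exact: mYA.
have fM : P [set w | B' (M N w)] \is a fin_num by apply: fin_num_measure; exact: mMB.
rewrite big_ord_recr /= eqxx EFinM EFinM !fineK //.
congr (_ * _)%E; rewrite indepYM //; congr _%:E; apply: eq_bigr => i _.
by rewrite (ltn_eqF (ltn_ord i)).
Qed.

Lemma past_measurable N : past N `<=` measurable.
Proof. by move=> _ [A [B [mA ->]]]; exact: measurable_rect. Qed.

Lemma pastT N : past N setT.
Proof.
exists (fun=> setT), (fun=> setT); split=> //.
by apply/seteqP; split.
Qed.

Lemma pastI N : setI_closed (past N).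
Proof.
move=> _ _ [A [B [mA ->]]] [A' [B' [mA' ->]]]; rewrite rectI.
by eexists; eexists; split; last reflexivity; move=> j; exact: measurableI.
Qed.

Lemma pastY_measurable N : pastY N `<=` measurable.
Proof.
move=> _ [A [B [C [mA mC ->]]]]; apply: measurableI; last exact: mYA.
exact: measurable_rect.
Qed.

Lemma pastYT N : pastY N setT.
Proof.
exists (fun=> setT), (fun=> setT), setT; split=> //.
by apply/seteqP; split.
Qed.

Lemma pastYI N : setI_closed (pastY N).
Proof.
move=> _ _ [A [B [C [mA mC ->]]]] [A' [B' [C' [mA' mC' ->]]]].
rewrite setIACA rectI.
exists (fun j => A j `&` A' j), (fun j => B j `&` B' j), (C `&` C').
by split=> // [j|]; exact: measurableI.
Qed.

Lemma indep_past_Y N E A : past N E -> measurable A ->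
  P (E `&` Y N @^-1` A) = (P E * P (Y N @^-1` A))%E.
Proof.
move=> [A0 [B0 [mA0 ->]]] mA; have := P_rectS A0 B0 N A setT mA0 mA.
by rewrite setIT probability_setT mule1.
Qed.

(** The realization is made real-valued through its index, so that [integral_indep] applies to
    it. *)
Lemma indep_pastY_M N E (A : set R) : pastY N E -> measurable A ->
  P (E `&` (fun w => (M N w)%:R : R) @^-1` A) =
  (P E * P ((fun w => (M N w)%:R : R) @^-1` A))%E.
Proof.
move=> [A0 [B0 [C [mA0 mC ->]]]] mA; rewrite -setIA.
rewrite (P_rectS A0 B0 N C (fun i => A i%:R)) // muleA; congr (_ * _)%E.
have := P_rectS A0 B0 N C setT mA0 mC.
by rewrite setIT probability_setT mule1.
Qed.

Lemma past_measurable_Y N j : (j < N)%N ->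
  measurable_fun setT (Y j : g_sigma_algebraType (past N) -> R).
Proof.
move=> jN _ A mA; rewrite setTI; apply: sub_sigma_algebra.
exists (fun i => if i == j then A else setT), (fun=> setT); split.
  by move=> i; case: ifP.
apply/seteqP; split=> w /=; last by move=> /(_ j jN) /=; rewrite eqxx => -[].
by move=> Aw i /= iN; split=> //=; case: ifPn => [/eqP ->|].
Qed.

Lemma past_measurable_M N j i : (j < N)%N ->
  measurable ([set w | M j w = i] : set (g_sigma_algebraType (past N))).
Proof.
move=> jN; apply: sub_sigma_algebra.
exists (fun=> setT), (fun i' => if i' == j then [set i] else setT); split=> //.
apply/seteqP; split=> w /=; last by move=> /(_ j jN) /=; rewrite eqxx => -[].
by move=> Mw i' /= iN; split=> //=; case: ifPn => [/eqP ->|].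
Qed.

Lemma past_sub_pastY N : <<s past N >> `<=` <<s pastY N >>.
Proof.
apply: sub_sigma_algebra2 => E [A0 [B0 [mA0 ->]]].
by exists A0, B0, setT; split=> //; rewrite (_ : [set w | _] = setT) ?setIT.
Qed.

Lemma measurable_past_pastY N (h : T -> R) :
  measurable_fun setT (h : g_sigma_algebraType (past N) -> R) ->
  measurable_fun setT (h : g_sigma_algebraType (pastY N) -> R).
Proof.
by move=> mh _ A mA; have := mh measurableT A mA; exact: past_sub_pastY.
Qed.

Lemma pastY_measurable_Y N :
  measurable_fun setT (Y N : g_sigma_algebraType (pastY N) -> R).
Proof.
move=> _ A mA; rewrite setTI; apply: sub_sigma_algebra.
exists (fun=> setT), (fun=> setT), A; split=> //.
by rewrite (_ : rect _ _ _ = setT) ?setTI //; apply/seteqP; split.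
Qed.

Lemma measurable_past N (h : T -> R) :
  measurable_fun setT (h : g_sigma_algebraType (past N) -> R) ->
  measurable_fun setT h.
Proof.
move=> mh _ A mA; have := mh measurableT A mA.
by apply: sub_g_sigma_algebra_measurable; exact: past_measurable.
Qed.

Lemma measurable_pastY N (h : T -> R) :
  measurable_fun setT (h : g_sigma_algebraType (pastY N) -> R) ->
  measurable_fun setT h.
Proof.
move=> mh _ A mA; have := mh measurableT A mA.
by apply: sub_g_sigma_algebra_measurable; exact: pastY_measurable.
Qed.

Lemma integral_pastY_M N i (g : T -> R) :
  measurable_fun setT (g : g_sigma_algebraType (pastY N) -> R) ->
  P.-integrable setT (fun w => (g w)%:E) ->
  P.-integrable setT (fun w => ((M N w == i)%:R * g w)%:E) /\
  (\int[P]_w ((M N w == i)%:R * g w)%:E = (p i)%:E * \int[P]_w (g w)%:E)%E.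
Proof.
move=> mg intg.
have indE (c : R) w : (M N w == i)%:R * c = \1_[set w | M N w = i] w * c.
  by rewrite indicE (_ : (w \in _) = (M N w == i)) //; apply/idP/eqP; rewrite inE.
have mI : measurable_fun setT (fun w => (M N w == i)%:R : R).
  rewrite (_ : (fun w => _) = \1_[set w | M N w = i]); first exact: measurable_indic.
  by apply/funext => w; have := indE 1 w; rewrite !mulr1.
have int1 : P.-integrable setT (fun w => ((M N w == i)%:R * g w)%:E).
  apply: le_integrable intg => //.
    apply/measurable_EFinP; apply: measurable_funM => //; exact: measurable_pastY mg.
  move=> w _; rewrite !abse_EFin lee_fin normrM; case: (_ == _); rewrite ?normr1 ?mul1r //.
  by rewrite normr0 mul0r.
split=> //.
have injR (w : T) : ((M N w)%:R == (i%:R : R)) = (M N w == i).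
  by rewrite eqr_nat.
have := integral_indep P (pastY N) (fun w => (M N w)%:R) (pastY_measurable N)
  (pastYT N) (pastYI N) _ (fun E A => indep_pastY_M N E A)
  (fun w z => (z == i%:R)%:R * g w).
under eq_integral do rewrite injR.
move=> ->.
- have E w : (\int[P]_w' (((M N w')%:R == (i%:R : R))%:R * g w)%:E = (p i * g w)%:E)%E.
    under eq_integral do rewrite injR indE EFinM.
    rewrite integralZr //; last first.
      by apply: integrable_indic => //; rewrite -ge0_fin_numE // fin_num_measure.
    rewrite integral_indic // setIT. by rewrite EFinM -(PM N i).
  under eq_integral do rewrite E EFinM.
  by rewrite integralZl.
- by apply: (measurable_fun_select (M N) (fun i _ => i%:R : R)).
- apply: measurable_funM; last first.
    exact: measurableT_comp mg measurable_fst.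
  rewrite (_ : (fun x => _) = \1_[set (i%:R : R)] \o snd); last first.
    apply/funext => -[w z] /=; rewrite indicE.
    by rewrite (_ : (z \in _) = (z == i%:R)) //; apply/idP/eqP; rewrite inE.
  by apply: measurableT_comp => //; apply: measurable_indic.
- by under eq_fun do rewrite injR.
Qed.

Lemma integral_pastY_select N (g : 'I_n -> T -> R) :
  (forall i, measurable_fun setT (g i : g_sigma_algebraType (pastY N) -> R)) ->
  (forall i, P.-integrable setT (fun w => (g i w)%:E)) ->
  (\int[P]_w (g (M N w) w)%:E = \int[P]_w (\sum_i p i * g i w)%:E)%E.
Proof.
move=> mg intg.
transitivity (\sum_i (p i)%:E * \int[P]_w (g i w)%:E)%E.
  rewrite (eq_integral (fun w => \sum_i ((M N w == i)%:R * g i w)%:E)%E); last first.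
    move=> w _; rewrite sumEFin; congr _%:E.
    rewrite (bigD1 (M N w)) //= eqxx mul1r big1 ?addr0 // => i.
    by rewrite eq_sym => /negbTE ->; rewrite mul0r.
  rewrite integral_sum //; last by move=> i; have [] := integral_pastY_M N i _ (mg i) (intg i).
  by apply: eq_bigr => i _; have [_] := integral_pastY_M N i _ (mg i) (intg i).
rewrite (eq_integral (fun w => \sum_i ((p i)%:E * (g i w)%:E))%E); last first.
  by move=> w _; rewrite -sumEFin.
rewrite integral_sum //; last by move=> i; exact: integrableZl.
by apply: eq_bigr => i _; rewrite integralZl.
Qed.

(** Provides the orthogonality needed by the strong law. First the realization of packet [N] is
    averaged out, then its interarrival time is integrated with the past frozen; the inner integral
    vanishes for every frozen past. *)
Lemma orthogonal_past N (h : T -> R) (g : 'I_n -> T -> R -> R) :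
  measurable_fun setT (h : g_sigma_algebraType (past N) -> R) ->
  (forall i, measurable_fun setT
     ((fun z => g i z.1 z.2) : g_sigma_algebraType (past N) * R -> R)) ->
  (\int[P]_w (h w ^+ 2)%:E < +oo)%E ->
  (forall i, \int[P]_w (g i w (Y N w) ^+ 2)%:E < +oo)%E ->
  (forall w i, P.-integrable setT (fun w' => (g i w (Y N w'))%:E)) ->
  (forall w, \int[P]_w' (\sum_i p i * g i w (Y N w'))%:E = 0)%E ->
  (\int[P]_w (h w * g (M N w) w (Y N w))%:E = 0)%E.
Proof.
move=> mh mg h2 g2 intg mean0.
have mgY i : measurable_fun setT
    ((fun w => g i w (Y N w)) : g_sigma_algebraType (pastY N) -> R).
  have mid : measurable_fun setT
      (id : g_sigma_algebraType (pastY N) -> g_sigma_algebraType (past N)).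
    by move=> _ A mA; rewrite setTI preimage_id; exact: past_sub_pastY.
  exact: measurableT_comp (mg i) (measurable_fun_pair mid (pastY_measurable_Y N)).
have inthg i : P.-integrable setT (fun w => (h w * g i w (Y N w))%:E).
  apply: integrableM_sqr => //; first exact: measurable_past mh.
  exact: measurable_pastY (mgY i).
rewrite (integral_pastY_select N (fun i w => h w * g i w (Y N w))) //; last first.
  move=> i; apply: measurable_funM => //; exact: measurable_past_pastY.
have E w y : \sum_i p i * (h w * g i w y) = h w * \sum_i p i * g i w y.
  by rewrite mulr_sumr; apply: eq_bigr => i _; rewrite mulrCA.
under eq_integral do rewrite E.
have := integral_indep P (past N) (Y N) (past_measurable N)
  (pastT N) (pastI N) (mY N) (fun E A => indep_past_Y N E A)
  (fun w y => h w * \sum_i p i * g i w y).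
move=> ->.
- rewrite integral0_eq // => w _.
  under eq_integral do rewrite EFinM.
  rewrite integralZl // ?mean0 ?mule0 //.
  rewrite (_ : (fun x => _) = (fun w' => \sum_i ((p i)%:E * (g i w (Y N w'))%:E)))%E; last first.
    by apply/funext => w'; rewrite -sumEFin.
  by apply: integrable_sum => // i _; exact: integrableZl.
- apply: measurable_funM; first exact: measurableT_comp mh measurable_fst.
  by apply: measurable_sum => i; apply: measurable_funM.
- under eq_fun do rewrite -E -sumEFin.
  apply: integrable_sum => // i _.
  under eq_fun do rewrite EFinM.
  exact: integrableZl.
Qed.

End filtration.

(** * Moments of the exponential law *)

(* Unlike [Num.max (y - v) 0 ^+ p], this is the indicator of [v < y] when
   [p = 0], which makes [integral_tail_pow] hold for all [p]. *)
Definition tail_pow {R : realType} (p : nat) (y v : R) : R :=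
  if v < y then (y - v) ^+ p else 0.

Lemma tail_pow_ge0 {R : realType} (p : nat) (y v : R) : 0 <= tail_pow p y v.
Proof. by rewrite /tail_pow; case: ifP => // lt; rewrite exprn_ge0 // subr_ge0 ltW. Qed.

Lemma integral_tail_pow {R : realType} (p : nat) (y v : R) :
  (\int[lebesgue_measure]_t (if (v <= t)%R then tail_pow p y t else 0)%:E =
   (tail_pow p.+1 y v / p.+1%:R)%:E)%E.
Proof.
pose f (t : R) := (if t \in `[v, y[ then (y - t) ^+ p else 0) : R.
have -> : (fun t : R => (if v <= t then tail_pow p y t else 0)%:E) = EFin \o f.
  apply/funext => t; rewrite /f /tail_pow /= in_itv /=.
  by case: (leP v t) => //= _.
have -> : EFin \o f = (EFin \o (fun t => (y - t) ^+ p)) \_ `[v, y[.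
  apply/funext => t; rewrite /f patchE /= mem_setE.
  by case: ifP.
rewrite -integral_mkcond /tail_pow; case: ifPn => [vy|]; last first.
  by rewrite -leNgt => yv; rewrite set_itv_ge ?integral_set0 ?mul0r // bnd_simp -leNgt.
pose F (t : R) := - (p.+1%:R)^-1 * (y - t) ^+ p.+1.
have p0 : p.+1%:R != 0 :> R by rewrite pnatr_eq0.
have dF (x : R) : is_derive x (1 : R) F ((y - x) ^+ p).
  have -> : F = (- (p.+1%:R)^-1) *: ((cst y - id) ^+ p.+1).
    by apply/funext => t; rewrite /F exprfctE.
  apply: is_derive_eq; rewrite /GRing.scale /= sub0r mulrN1 mulNr mulrN opprK.
  by rewrite mulKf.
rewrite (integral_co_antiderivative _ F _ _ (ltW vy) _ dF).
  by rewrite /F subrr expr0n /= mulr0 sub0r mulNr opprK mulrC.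
move=> x; apply: (@continuous_comp _ _ _ (fun t => y - t) (fun z => z ^+ p)).
  by apply: cvgB; [exact: cvg_cst|exact: cvg_id].
exact: exprn_continuous.
Qed.

Section exponential_moments.
Context {d : measure_display} {T : measurableType d} {R : realType}.
Variables (P : probability T R) (lam : R) (Y : T -> R).
Hypotheses (lam0 : 0 < lam) (mY : measurable_fun setT Y).
Hypothesis expY : exponential_cdf P lam Y.

Lemma measurable_tail_pow {d' : measure_display} {U : measurableType d'}
    (p : nat) (f g : U -> R) : measurable_fun setT f -> measurable_fun setT g ->
  measurable_fun setT (fun u => tail_pow p (f u) (g u)).
Proof.
move=> mf mg; apply: measurable_fun_ifT => //; first exact: measurable_fun_ltr.
by apply: measurable_funX; exact: measurable_funB.
Qed.

Lemma integral_expR_tail (v : R) :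
  (\int[lebesgue_measure]_(t in `[v, +oo[) (expR (- (lam * t)))%:E =
   (expR (- (lam * v)) / lam)%:E)%E.
Proof.
have lamn0 : lam != 0 by rewrite gt_eqF.
pose F (t : R) := - lam^-1 * expR (- (lam * t)).
have dF (x : R) : is_derive x (1 : R) F (expR (- (lam * x))).
  have -> : F = (- lam^-1) *: (expR \o (- (lam *: id))) by [].
  apply: is_derive_eq; rewrite /GRing.scale /= (_ : (- _) x = - (lam * x)) //.
  by field.
have cF x : F t @[t --> x] --> F x.
  by apply: differentiable_continuous; apply/derivable1_diffP; exact: ex_derive.
rewrite (@ge0_continuous_FTC2y _ _ F v 0).
- by rewrite /F sub0e -EFinN mulNr opprK mulrC.
- by move=> x _; exact: expR_ge0.
- apply: continuous_subspaceT => x; apply: continuous_comp; last exact: continuous_expR.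
  by apply: continuousN; apply: continuousM => //; exact: cst_continuous.
- rewrite -[X in _ --> X](mulr0 (- lam^-1)); apply: cvgM; first exact: cvg_cst.
  apply: (@cvg_comp _ _ _ (fun t => lam * t) (fun z => expR (- z)) _ +oo%R); last exact: cvgr_expR.
  exact: gt0_cvgMry.
- by move=> x _; exact: ex_derive.
- exact/cvg_at_right_filter.
- by move=> x _; rewrite derive1E; apply: derive_val.
Qed.

(** Only the distribution function is used, not a density. The case [p = 0] is the tail probability,
    and by [integral_tail_pow] and Tonelli each further power costs one integration over the
    threshold. *)
Lemma exponential_moment (p : nat) (v : R) : 0 <= v ->
  (\int[P]_w (tail_pow p (Y w) v)%:E =
   (p`!%:R / lam ^+ p * expR (- (lam * v)))%:E)%E.
Proof.
elim: p v => [|p IH] v v0.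
  rewrite (eq_integral (EFin \o \1_(~` [set w | Y w <= v]))); last first.
    move=> w _; rewrite /tail_pow /= indicE.
    by rewrite in_setC mem_setE -ltNge; case: ifP.
  have mle : measurable [set w | Y w <= v].
    by rewrite -[X in measurable X]setTI; exact: measurable_fun_le.
  transitivity (P (~` [set w | Y w <= v])).
    by rewrite integral_indic ?setIT //; exact: measurableC.
  rewrite probability_setC // expY ltNge v0 /= -EFinB; congr _%:E.
  by rewrite expr0 divr1 mul1r opprB addrC subrK.
have -> : (\int[P]_w (tail_pow p.+1 (Y w) v)%:E = (p.+1%:R)%:E *
    \int[P]_w \int[lebesgue_measure]_t (if (v <= t)%R then tail_pow p (Y w) t else 0)%:E)%E.
  under [in RHS]eq_integral do rewrite integral_tail_pow.
  rewrite -ge0_integralZl //; last 2 first.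
  - apply/measurable_EFinP; apply: measurable_funM => //.
    exact: measurable_tail_pow.
  - by move=> w _; rewrite lee_fin divr_ge0 // tail_pow_ge0.
  apply: eq_integral => w _; rewrite -EFinM; congr _%:E.
  by rewrite mulrC divfK // pnatr_eq0.
rewrite (@fubini_tonelli _ _ _ _ _ P lebesgue_measure
  (fun z => (if (v <= z.2)%R then tail_pow p (Y z.1) z.2 else 0)%:E)); last 2 first.
- apply/measurable_EFinP; apply: measurable_fun_ifT => //.
    exact: measurable_fun_ler.
  apply: measurable_tail_pow => //; exact: measurableT_comp.
- by move=> z; rewrite lee_fin; case: ifP => // _; exact: tail_pow_ge0.
transitivity ((p.+1%:R)%:E * \int[lebesgue_measure]_(t in `[v, +oo[)
   (p`!%:R / lam ^+ p * expR (- (lam * t)))%:E)%E.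
  congr (_ * _)%E; rewrite [RHS]integral_mkcond; apply: eq_integral => t _.
  rewrite patchE mem_setE in_itv /= andbT; case: ifPn => vt.
    by rewrite IH // (le_trans v0).
  by rewrite integral0.
under eq_integral do rewrite EFinM.
rewrite ge0_integralZl //; last 2 first.
- apply/measurable_EFinP; apply: measurable_funTS; apply: measurableT_comp => //.
  by apply: measurableT_comp => //; exact: measurable_funM.
- by rewrite lee_fin divr_ge0 // exprn_ge0 // ltW.
rewrite integral_expR_tail -!EFinM; congr _%:E.
by rewrite factS natrM exprS; field; rewrite expf_neq0 // gt_eqF.
Qed.
End exponential_moments.

Set Implicit Arguments.
Unset Strict Implicit.

(** * Expectations bundled with integrability *)

Section has_mean.
Context {d : measure_display} {T : measurableType d} {R : realType}.
Variable P : probability T R.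
Implicit Types (f g : T -> R) (c : R).

(** Keeping integrability next to the value lets both pass together through linear combinations. *)
Definition has_mean f c := P.-integrable setT (fun w => (f w)%:E) /\
  (\int[P]_w (f w)%:E = c%:E)%E.

Lemma has_mean_cst c : has_mean (fun=> c) c.
Proof.
split; first exact: finite_measure_integrable_cst.
by rewrite integral_cst // -[RHS]mule1 -(probability_setT P).
Qed.

Lemma has_meanD f g c c' : has_mean f c -> has_mean g c' ->
  has_mean (fun w => f w + g w) (c + c').
Proof.
move=> [If fc] [Ig gc]; split; first exact: (integrableD measurableT If Ig).
by under eq_integral do rewrite EFinD; rewrite integralD // fc gc.
Qed.

Lemma has_meanZ a f c : has_mean f c -> has_mean (fun w => a * f w) (a * c).
Proof.
move=> [If fc]; split.
  by under eq_fun do rewrite EFinM; exact: integrableZl.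
by under eq_integral do rewrite EFinM; rewrite integralZl // fc.
Qed.

Lemma has_meanB f g c c' : has_mean f c -> has_mean g c' ->
  has_mean (fun w => f w - g w) (c - c').
Proof.
move=> hf /(has_meanZ (-1)) hg; have := has_meanD hf hg.
by rewrite mulN1r; under eq_fun do rewrite mulN1r.
Qed.

Lemma has_mean_sum (I : finType) (F : I -> T -> R) (c : I -> R) :
  (forall i, has_mean (F i) (c i)) ->
  has_mean (fun w => \sum_i F i w) (\sum_i c i).
Proof.
move=> h; split.
  under eq_fun do rewrite -sumEFin.
  by apply: integrable_sum => // i _; have [] := h i.
under eq_integral do rewrite -sumEFin.
rewrite integral_sum //; last by move=> i; have [] := h i.
by rewrite -sumEFin; apply: eq_bigr => i _; have [] := h i.
Qed.

Lemma has_mean_ext f g c c' : has_mean f c -> (forall w, f w = g w) -> c = c' ->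
  has_mean g c'.
Proof. by move=> + /funext <- <-. Qed.

Lemma ge0_has_mean f c : measurable_fun setT f -> (forall w, 0 <= f w) ->
  (\int[P]_w (f w)%:E = c%:E)%E -> has_mean f c.
Proof.
move=> mf f0 fc; split=> //; apply/integrableP; split; first exact/measurable_EFinP.
by under eq_integral do rewrite gee0_abs ?lee_fin //; rewrite fc ltry.
Qed.

Lemma has_mean_indic (A : set T) c : measurable A -> P A = c%:E ->
  has_mean (\1_A) c.
Proof.
move=> mA PA; apply: ge0_has_mean => //.
by rewrite integral_indic // setIT.
Qed.

Lemma has_mean_le f g c c' : has_mean f c -> has_mean g c' ->
  (forall w, f w <= g w) -> c <= c'.
Proof.
move=> [If fc] [Ig gc] fg; rewrite -lee_fin -fc -gc; apply: le_integral => //.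
by move=> w _; rewrite lee_fin.
Qed.

Lemma has_mean_dominated f g c : measurable_fun setT f ->
  (forall w, `|f w| <= g w) -> has_mean g c -> exists c', has_mean f c'.
Proof.
move=> mf fg [Ig gc].
have If : P.-integrable setT (fun w => (f w)%:E).
  apply: le_integrable Ig => //; first exact/measurable_EFinP.
  move=> w _; rewrite !abse_EFin lee_fin; apply: (le_trans (fg w)); exact: ler_norm.
exists (fine (\int[P]_w (f w)%:E)); split=> //.
by rewrite fineK //; exact: integrable_fin_num.
Qed.
End has_mean.

Unset Implicit Arguments.
Set Strict Implicit.

(** * Means of shifted and truncated exponential variables *)

Section exponential_means.
Context {d : measure_display} {T : measurableType d} {R : realType}.
Variables (P : probability T R) (lam : R) (Y : T -> R).
Hypotheses (lam0 : 0 < lam) (mY : measurable_fun setT Y) (Y0 : forall w, 0 <= Y w).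
Hypothesis expY : exponential_cdf P lam Y.

Lemma tail_pow_mean (p : nat) (v : R) : 0 <= v -> has_mean P (fun w => tail_pow p (Y w) v)
  (p`!%:R / lam ^+ p * expR (- (lam * v))).
Proof.
move=> v0; apply: ge0_has_mean.
- exact: measurable_tail_pow.
- by move=> w; exact: tail_pow_ge0.
- exact: exponential_moment.
Qed.

Lemma exponential_pow_mean p : has_mean P (fun w => Y w ^+ p.+1) (p.+1`!%:R / lam ^+ p.+1).
Proof.
have h := tail_pow_mean p.+1 0 (lexx 0); apply: (has_mean_ext h); last first.
  by rewrite mulr0 oppr0 expR0 mulr1.
move=> w; rewrite /tail_pow subr0; case: ltP => // Yw.
by rewrite (_ : Y w = 0) ?expr0n //; apply/eqP; rewrite eq_le Yw Y0.
Qed.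

Lemma measurable_set_le (v : R) : measurable [set w | Y w <= v].
Proof. by rewrite -[X in measurable X]setTI; exact: measurable_fun_le. Qed.

Lemma measurable_set_eq (v : R) : measurable [set w | Y w = v].
Proof.
rewrite -[X in measurable X]setTI.
exact: (mY measurableT [set v] (measurable_set1 v)).
Qed.

(** An atom of mass [c] at [v] would be a jump of the distribution function, yet its increment over
    a step of length [c / (4 * lam)] is at most [expR (c / 4) - 1], which is less than [c] when
    [0 < c <= 1]. *)
Lemma exponential_no_atom (v : R) : 0 <= v -> P [set w | Y w = v] = 0%E.
Proof.
move=> v0; set A := [set w | Y w = v].
have fA : P A \is a fin_num by apply: fin_num_measure; exact: measurable_set_eq.
have c0 : 0 <= fine (P A) by rewrite fine_ge0.
rewrite -(fineK fA); congr _%:E; apply/eqP; rewrite eq_le c0 andbT leNgt.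
move: (fine (P A)) (fineK fA) c0 => c Pc c0; apply/negP => cpos.
have c1 : c <= 1 by rewrite -lee_fin Pc; apply: probability_le1; exact: measurable_set_eq.
have le : (P A + P [set w | (Y w <= v - c / 4 / lam)%R] <= P [set w | (Y w <= v)%R])%E.
  rewrite -measureU //; first 1 last.
  - exact: measurable_set_eq.
  - exact: measurable_set_le.
  - apply/seteqP; split=> w //= [-> h].
    have : 0 < c / 4 / lam by rewrite !divr_gt0.
    by move: (c / 4 / lam) h => z; lra.
  apply: le_measure; rewrite ?inE.
  - by apply: measurableU; [exact: measurable_set_eq|exact: measurable_set_le].
  - exact: measurable_set_le.
  - move=> w [/= ->//|/= h]; apply: (le_trans h); rewrite lerBlDr lerDl !divr_ge0 // ltW //.
move: le; rewrite -Pc !expY [in X in (_ <= X)%E]ltNge v0 /= -EFinD lee_fin.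
have lamn0 : lam != 0 by rewrite gt_eqF.
have u0 : 0 < c / 4 by rewrite divr_gt0.
have eD : expR (- (lam * (v - c / 4 / lam))) = expR (- (lam * v)) * expR (c / 4).
  by rewrite -expRD; congr expR; field.
have E1 : expR (- (lam * v)) <= 1 by rewrite -expR0 ler_expR oppr_le0 mulr_ge0 // ltW.
have E0 := expR_ge0 (- (lam * v)).
have Eu : expR (c / 4) * expR (- (c / 4)) = 1 by rewrite -expRD subrr expR0.
have Eu1 := expR_ge1Dx (- (c / 4)).
have Eu2 := expR_ge1Dx (c / 4).
(* [I] is the distribution function at [v - c / 4 / lam]. If that point is negative, the exponential
   expression is at most 0, so it remains a lower bound. *)
set I := if _ then _ else _ => le.
have leI : 1 - expR (- (lam * v)) * expR (c / 4) <= I.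
  rewrite -eD /I; case: ifP => // neg; rewrite subr_le0 -[leLHS]expR0 ler_expR.
  by rewrite -mulrN mulr_ge0 ?oppr_ge0 // ltW.
have le1 : c <= expR (- (lam * v)) * (expR (c / 4) - 1) by lra.
have le2 : c <= expR (c / 4) - 1.
  by apply: (le_trans le1); apply: ler_piMl => //; lra.
by nra.
Qed.

(** Acceptance uses a non-strict inequality whereas [tail_pow 0] is strict; the absence of atoms
    bridges the gap. *)
Lemma indic_ge_mean (v : R) : 0 <= v ->
  has_mean P (fun w => (v <= Y w)%R%:R) (expR (- (lam * v))).
Proof.
move=> v0; have h := has_mean_indic (measurable_set_eq v) (exponential_no_atom v v0).
apply: (has_mean_ext (has_meanD (tail_pow_mean 0 v v0) h)); last first.
  by rewrite expr0 divr1 mul1r addr0.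
move=> w; rewrite /tail_pow indicE expr0 /= (_ : (w \in _) = (Y w == v)); last first.
  by apply/idP/eqP; rewrite inE.
by case: (ltgtP v (Y w)); rewrite ?addr0 ?add0r.
Qed.

(** For [x < 0] this is memorylessness: given that [Y] passes [- x], the overshoot has mean
    [lam^-1]. *)
Lemma excess_mean0 (x : R) : has_mean P (fun w => Num.max (x + Y w) 0 - Num.max x 0 -
    lam^-1 * (0 <= x + Y w)%R%:R) 0.
Proof.
have h1 := exponential_pow_mean 0.
have [x0|x0] := leP 0 x.
  apply: (has_mean_ext (has_meanB h1 (has_mean_cst P lam^-1))); last first.
    by rewrite (_ : 1`! = 1%N) // expr1 mul1r subrr.
  by move=> w; rewrite expr1 addr_ge0 // max_l ?addr_ge0 //=; ring.
have v0 : 0 <= - x by rewrite oppr_ge0 ltW.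
apply: (has_mean_ext (has_meanB (tail_pow_mean 1 _ v0)
  (has_meanZ lam^-1 (indic_ge_mean _ v0)))); last by rewrite (_ : 1`! = 1%N) // expr1 mul1r subrr.
move=> w; rewrite /tail_pow ?(max_r (ltW x0)) subr0 expr1 opprK.
rewrite -[_ <= Y w]subr_ge0 opprK [Y w + x]addrC -[_ < Y w]subr_gt0 opprK [Y w + x]addrC.
by case: ltP => h; rewrite ?(max_l (ltW h)) ?(max_r h).
Qed.

(** For [x < 0] it compares the second and first moments of the memoryless overshoot; for [x >= 0]
    nothing is truncated and it is a polynomial identity in the moments of [Y]. *)
Lemma excess_sqr_mean0 (x : R) : has_mean P (fun w => Num.max (x + Y w) 0 ^+ 2 -
    Num.max x 0 ^+ 2 - 2 * lam^-1 * Num.max (x + Y w) 0) 0.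
Proof.
have lamn0 : lam != 0 by rewrite gt_eqF.
have h1 := exponential_pow_mean 0; have h2 := exponential_pow_mean 1.
have [x0|x0] := leP 0 x.
  apply: (has_mean_ext (has_meanB (has_meanD h2
    (has_meanZ (2 * x - 2 * lam^-1) h1)) (has_mean_cst P (2 * x * lam^-1)))); last first.
    by rewrite (_ : 1`! = 1%N) // (_ : 2`! = 2%N) //; field.
  by move=> w; rewrite ?(max_l x0) max_l ?addr_ge0 //; ring.
have v0 : 0 <= - x by rewrite oppr_ge0 ltW.
apply: (has_mean_ext (has_meanB (tail_pow_mean 2 _ v0)
  (has_meanZ (2 * lam^-1) (tail_pow_mean 1 _ v0)))); last first.
  by rewrite (_ : 1`! = 1%N) // (_ : 2`! = 2%N) //; field.
move=> w; rewrite /tail_pow ?(max_r (ltW x0)) expr0n subr0.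
rewrite -[_ < Y w]subr_gt0 opprK [Y w + x]addrC.
by case: ltP => h; rewrite ?(max_l (ltW h)) ?(max_r h) ?expr0n ?mulr0 ?subr0.
Qed.
End exponential_means.

(** * Martingale differences driven by the state *)

Section model.
Context {d : measure_display} {T : measurableType d} {R : realType} {n : nat}.
Variables (P : probability T R) (p : 'I_n -> R) (k : nat) (len : 'I_n -> nat).
Variables (lam : R) (Y : nat -> T -> R) (M : nat -> T -> 'I_n).
Hypotheses (lam0 : 0 < lam) (p0 : forall i, 0 <= p i) (p1 : \sum_i p i = 1).
Hypothesis q0 : 0 < q_k k p.
Hypothesis mY : forall j, measurable_fun setT (Y j).
Hypothesis mM : forall j i, measurable [set w | M j w = i].
Hypothesis Y0 : forall j w, 0 <= Y j w.
Hypothesis expY : forall j, exponential_cdf P lam (Y j).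
Hypothesis PM : forall j i, P [set w | M j w = i] = (p i)%:E.
Hypothesis indepYM : mutually_independent P Y M.

Let b j w := elapsed k len (Y^~ w) (M^~ w) j.
Let l j w := lastlen k len (Y^~ w) (M^~ w) j.
Let L : R := \sum_i (len i)%:R.

Lemma has_mean_select N (g : 'I_n -> T -> R) (c : 'I_n -> R) :
  (forall i, measurable_fun setT (g i : g_sigma_algebraType (pastY Y M N) -> R)) ->
  (forall i, has_mean P (g i) (c i)) ->
  has_mean P (fun w => g (M N w) w) (\sum_i p i * c i).
Proof.
move=> mg hg.
have h i : has_mean P (fun w => (M N w == i)%:R * g i w) (p i * c i).
  have [Ig gc] := hg i.
  have [I1 E1] := integral_pastY_M P Y M p mY mM PM indepYM N i _ (mg i) Ig.
  by split=> //; rewrite E1 gc.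
apply: (has_mean_ext (has_mean_sum h)) => // w.
rewrite (bigD1 (M N w)) //= eqxx mul1r big1 ?addr0 // => i.
by rewrite eq_sym => /negbTE ->; rewrite mul0r.
Qed.

Let measurable_b_past N : measurable_fun setT (b N : g_sigma_algebraType (past Y M N) -> R) /\
  measurable_fun setT (l N : g_sigma_algebraType (past Y M N) -> R).
Proof.
apply: (@measurable_state _ (g_sigma_algebraType (past Y M N)) R n k len N Y M) => //.
- by move=> j; exact: past_measurable_Y.
- by move=> j i; exact: past_measurable_M.
Qed.

Let mb N : measurable_fun setT (b N).
Proof. by apply: (measurable_past Y M mY mM N); have [] := measurable_b_past N. Qed.

Let ml N : measurable_fun setT (l N).
Proof. by apply: (measurable_past Y M mY mM N); have [] := measurable_b_past N. Qed.

Let b0 N w : 0 <= b N w.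
Proof. by apply: elapsed_ge0 => j. Qed.

Let l0 N w : 0 <= l N w. Proof. exact: lastlen_ge0. Qed.

Let lL N w : l N w <= L. Proof. exact: lastlen_le. Qed.

Let L0 : 0 <= L. Proof. by rewrite sumr_ge0. Qed.

Let q1 : q_k k p <= 1.
Proof.
by rewrite -p1 /q_k [leRHS](bigID (fun i : 'I_n => (i < k)%N)) /= lerDl sumr_ge0.
Qed.

Let sum_rejected : \sum_i p i * (k <= i)%N%:R = 1 - q_k k p.
Proof.
rewrite -[X in _ = X - _]p1 /q_k [X in _ = X - _](bigID (fun i : 'I_n => (i < k)%N)) /=.
rewrite addrAC subrr add0r.
rewrite [RHS]big_mkcond /=; apply: eq_bigr => i _; rewrite -leqNgt.
by case: (k <= i)%N; rewrite ?mulr1 ?mulr0.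
Qed.

(** The weighted inequality for squares applied twice. A small [e] keeps the coefficient of [u ^ 4]
    close to 1, which preserves a contraction. *)
Lemma pow4_add_le (u v e : R) : 0 < e ->
  (u + v) ^+ 4 <= (1 + e) ^+ 3 * u ^+ 4 + (1 + e^-1) ^+ 3 * v ^+ 4.
Proof.
move=> e0.
have sq (a c : R) : (a + c) ^+ 2 <= (1 + e) * a ^+ 2 + (1 + e^-1) * c ^+ 2.
  rewrite -subr_ge0 (_ : _ - _ = e^-1 * (e * a - c) ^+ 2); last by field; rewrite gt_eqF.
  by rewrite mulr_ge0 ?sqr_ge0 // invr_ge0 ltW.
have -> : (u + v) ^+ 4 = ((u + v) ^+ 2) ^+ 2 by rewrite -exprM.
apply: (@le_trans _ _ (((1 + e) * u ^+ 2 + (1 + e^-1) * v ^+ 2) ^+ 2)).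
  by rewrite lerXn2r ?nnegrE ?sqr_ge0 // (le_trans _ (sq u v)) ?sqr_ge0.
apply: (le_trans (sq _ _)); rewrite le_eqVlt; apply/orP; left; apply/eqP; ring.
Qed.

(* An encoded packet resets [b] or finds it below [L], so that [b ^ 4]
   contracts in mean by a factor close to [1 - q] at each step. *)
Lemma elapsed_moment4 : exists C : R, forall N,
  exists2 c, c <= C & has_mean P (fun w => b N w ^+ 4) c.
Proof.
(* With [e = q / 8] the factor [(1 + e) ^ 3 * (1 - q)] is at most [1 - q / 2]. The bound [2 * K / q]
   is the fixed point of the map sending [c] to [(1 - q / 2) * c + K]. *)
pose q := q_k k p; pose e := q / 8; pose y4 : R := 4`!%:R / lam ^+ 4.
have qp : 0 < q := q0.
have e0 : 0 < e by rewrite divr_gt0.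
pose K := (1 + e^-1) ^+ 3 * (2 ^+ 3 * y4 + 2 ^+ 3 * L ^+ 4).
have K0 : 0 <= K.
  have ei0 : 0 <= 1 + e^-1 by rewrite addr_ge0 // invr_ge0 ltW.
  have y40 : 0 <= y4 by rewrite divr_ge0 // exprn_ge0 // ltW.
  by rewrite mulr_ge0 ?exprn_ge0 // addr_ge0 // mulr_ge0 ?exprn_ge0.
exists (2 * K / q); elim=> [|N [c cC hc]].
  exists 0; first by apply: divr_ge0; [exact: mulr_ge0|exact: ltW].
  by apply: (has_mean_ext (has_mean_cst P 0)) => // w; rewrite expr0n.
have hsel : has_mean P (fun w => (k <= M N w)%N%:R * b N w ^+ 4) ((1 - q) * c).
  have -> : (1 - q) * c = \sum_i p i * ((k <= i)%N%:R * c).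
    by rewrite -sum_rejected mulr_suml; apply: eq_bigr => i _; rewrite mulrA.
  apply: (has_mean_select N (fun i w => (k <= i)%N%:R * b N w ^+ 4)) => i; last exact: has_meanZ.
  apply: measurable_past_pastY; apply: measurable_funM => //.
  by apply: measurable_funX; have [] := measurable_b_past N.
have hY := exponential_pow_mean P lam (Y N) lam0 (mY N) (Y0 N) (expY N) 3.
have hdom := has_meanD (has_meanZ ((1 + e) ^+ 3) hsel)
  (has_meanZ ((1 + e^-1) ^+ 3)
    (has_meanD (has_meanZ (2 ^+ 3) hY) (has_mean_cst P (2 ^+ 3 * L ^+ 4)))).
have dom w : b N.+1 w ^+ 4 <= (1 + e) ^+ 3 * ((k <= M N w)%N%:R * b N w ^+ 4) +
    (1 + e^-1) ^+ 3 * (2 ^+ 3 * Y N w ^+ 4 + 2 ^+ 3 * L ^+ 4).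
  apply: (@le_trans _ _ (((k <= M N w)%N%:R * b N w + (Y N w + L)) ^+ 4)).
    rewrite lerXn2r ?nnegrE //; last by apply: elapsed_le => j.
    by rewrite !addr_ge0 ?mulr_ge0.
  apply: (le_trans (pow4_add_le _ _ _ e0)); rewrite exprMn; apply: lerD.
    by case: (k <= _)%N; rewrite ?expr1n // expr0n !mul0r.
  apply: ler_wpM2l; first by rewrite exprn_ge0 // addr_ge0 // invr_ge0 ltW.
  by have := pow4_add_le (Y N w) L 1 ltr01; rewrite invr1 -[1 + 1](mulr2n 1).
have [||c' hc'] := has_mean_dominated (f := fun w => b N.+1 w ^+ 4) _ _ hdom.
- exact: measurable_funX.
- by move=> w; rewrite ger0_norm ?exprn_ge0.
exists c' => //; apply: (le_trans (has_mean_le hc' hdom dom)); rewrite -/K.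
have qe : (1 + e) ^+ 3 * (1 - q) <= 1 - q / 2.
  by rewrite /e; have := q0; have := q1; rewrite -/q; nra.
have c0 : 0 <= c.
  by apply: (has_mean_le (has_mean_cst P 0) hc) => w; exact: exprn_ge0.
apply: (@le_trans _ _ ((1 - q / 2) * (2 * K / q) + K)).
  rewrite lerD2r mulrA; apply: ler_pM => //.
  by rewrite mulr_ge0 ?exprn_ge0 ?subr_ge0 // addr_ge0 // ltW.
by rewrite le_eqVlt; apply/orP; left; apply/eqP; field; rewrite gt_eqF.
Qed.

(** Bounded fourth moments make the second moments of these quotients summable. It is needed because
    the boundary term of [area_identity] is quadratic in the state. *)
Lemma elapsed_sqr_cvg0 :
  {ae P, forall w, (b N w ^+ 2 / N.+1%:R) @[N --> \oo] --> (0 : R)}.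
Proof.
have [C hC] := elapsed_moment4.
apply: (sqr_summable_cvg0 P _ C) => N.
  by apply: measurable_funM => //; exact: measurable_funX.
have [c cC hc] := hC N.
have [_ E] := has_meanZ (N.+1%:R ^+ 2)^-1 hc.
rewrite (eq_integral (fun w => ((N.+1%:R ^+ 2)^-1 * b N w ^+ 4)%:E)); last first.
  by move=> w _; rewrite exprMn -exprM exprVn mulrC.
by rewrite E lee_fin mulrC ler_wpM2r // invr_ge0 exprn_ge0.
Qed.

Section martingale.
Variables (phi : 'I_n -> R -> R -> R -> R) (K : R).
Hypothesis mphi : forall i, measurable_fun setT
  ((fun z => phi i z.1.1 z.1.2 z.2) : R * R * R -> R).
Hypothesis phi_le : forall i x z y,
  `|phi i x z y| <= K * (1 + x ^+ 2 + z ^+ 2 + y ^+ 2).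
Hypothesis phi_mean0 : forall N x z,
  has_mean P (fun w => \sum_i p i * phi i x z (Y N w)) 0.

Let D N w := phi (M N w) (b N w) (l N w) (Y N w).

Let measurable_phi {d' : measure_display} {U : measurableType d'} i (f g h : U -> R) :
  measurable_fun setT f -> measurable_fun setT g -> measurable_fun setT h ->
  measurable_fun setT (fun u => phi i (f u) (g u) (h u)).
Proof.
move=> mf mg mh; have mp := measurable_fun_pair (measurable_fun_pair mf mg) mh.
exact: measurableT_comp (mphi i) mp.
Qed.

Let K0 : 0 <= K.
Proof.
have [i _|no] := pickP (xpredT : pred 'I_n); last first.
  by have /eqP := p1; rewrite big_pred0 // eq_sym oner_eq0.
have := le_trans (normr_ge0 _) (phi_le i 0 0 0).
by rewrite !expr0n !addr0 mulr1.
Qed.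

(** Since [phi] grows at most quadratically, the bounded fourth moments of the state and of [Y]
    bound the second moments of the differences, and [orthogonal_past] gives their orthogonality to
    the partial sums. *)
Lemma martingale_strong_law :
  {ae P, forall w, ((\sum_(j < N) D j w) / N%:R) @[N --> \oo] --> (0 : R)}.
Proof.
have [C hC] := elapsed_moment4.
(* The factor 4 is Cauchy-Schwarz on the four terms of [phi_le]; the terms after 1 bound the fourth
   moments of [b], [l] and [Y]. *)
pose B : R := 4 * K ^+ 2 * (1 + C + L ^+ 4 + 4`!%:R / lam ^+ 4).
have bound N : exists2 c, c <= B & exists2 F, has_mean P F c &
    (forall i w, phi i (b N w) (l N w) (Y N w) ^+ 2 <= F w).
  have [c cC hc] := hC N.
  have hY := exponential_pow_mean P lam (Y N) lam0 (mY N) (Y0 N) (expY N) 3.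
  exists (4 * K ^+ 2 * (1 + c + L ^+ 4 + 4`!%:R / lam ^+ 4)).
    by rewrite ler_wpM2l ?mulr_ge0 ?exprn_ge0 // !lerD2r lerD2l.
  exists (fun w => 4 * K ^+ 2 * (1 + b N w ^+ 4 + L ^+ 4 + Y N w ^+ 4)).
    exact: (has_meanZ _ (has_meanD (has_meanD (has_meanD (has_mean_cst P 1) hc)
      (has_mean_cst P (L ^+ 4))) hY)).
  move=> i w; have le1 := phi_le i (b N w) (l N w) (Y N w).
  rewrite -real_normK ?num_real //.
  apply: (@le_trans _ _ ((K * (1 + b N w ^+ 2 + l N w ^+ 2 + Y N w ^+ 2)) ^+ 2)).
    by rewrite lerXn2r ?nnegrE ?mulr_ge0 ?addr_ge0 ?sqr_ge0.
  apply: (@le_trans _ _ (4 * K ^+ 2 * (1 + b N w ^+ 4 + l N w ^+ 4 + Y N w ^+ 4))).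
    have := sqr_sum_le 4 (fun i => nth 0 [:: 1; b N w ^+ 2; l N w ^+ 2; Y N w ^+ 2] i).
    rewrite !big_ord_recr !big_ord0 /= !add0r expr1n -!exprM exprMn => h.
    apply: (@le_trans _ _ (K ^+ 2 * (4 * (1 + b N w ^+ 4 + l N w ^+ 4 + Y N w ^+ 4)))).
      by apply: ler_wpM2l => //; exact: exprn_ge0.
    by rewrite [4 * K ^+ 2]mulrC mulrA.
  rewrite ler_wpM2l ?mulr_ge0 ?exprn_ge0 // lerD2r lerD2l.
  by rewrite lerXn2r ?nnegrE.
have mphi_i N i : measurable_fun setT (fun w => phi i (b N w) (l N w) (Y N w)).
  exact: measurable_phi.
have mD N : measurable_fun setT (D N).
  exact: (measurable_fun_select (M N) (fun i w => phi i (b N w) (l N w) (Y N w))).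
(* The index may depend on [w], so the bound serves both [D N] and each [phi i] with [i] fixed. *)
have sqr_le N (f : T -> R) : measurable_fun setT f ->
    (forall w, exists i, f w = phi i (b N w) (l N w) (Y N w)) ->
    (\int[P]_w (f w ^+ 2)%:E <= B%:E)%E.
  move=> mf fE; have [c cB [F [IF FE] hF]] := bound N.
  apply: (@le_trans _ _ c%:E); last by rewrite lee_fin.
  rewrite -FE; apply: ge0_le_integral => //.
  - by move=> w _; rewrite lee_fin sqr_ge0.
  - exact: measurable_sqr.
  - exact: measurable_int IF.
  - by move=> w _; have [i ->] := fE w; rewrite lee_fin.
apply: (orthogonal_strong_law P D B mD).
  by move=> N; apply: (sqr_le N) => // w; exists (M N w).
move=> N S2.
have [mbp mlp] := measurable_b_past N.
apply: (orthogonal_past P Y M p mY mM PM indepYM N _ (fun i w y => phi i (b N w) (l N w) y)) => //.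
- apply: measurable_sum => j; have jN := ltn_ord j.
  have mYp i : (i < N)%N -> measurable_fun setT (Y i : g_sigma_algebraType (past Y M N) -> R).
    exact: past_measurable_Y.
  have mMp i i' : (i < N)%N ->
      measurable ([set w | M i w = i'] : set (g_sigma_algebraType (past Y M N))).
    exact: past_measurable_M.
  have [mbj mlj] := @measurable_state _ (g_sigma_algebraType (past Y M N)) R n
    k len N Y M mYp mMp j (ltnW jN).
  apply: (measurable_fun_select (M j : g_sigma_algebraType (past Y M N) -> 'I_n)
    (fun i w => phi i (b j w) (l j w) (Y j w))) => i; first exact: mMp.
  by apply: measurable_phi => //; exact: mYp.
- move=> i; apply: measurable_phi => //; exact: measurableT_comp.
- move=> i; apply: le_lt_trans (ltry B); apply: (sqr_le N) => // w; by exists i.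
- move=> w i.
  have hY := exponential_pow_mean P lam (Y N) lam0 (mY N) (Y0 N) (expY N) 1.
  have [||c [//]] := has_mean_dominated (f := fun w' => phi i (b N w) (l N w) (Y N w')) _ _
    (has_meanZ K (has_meanD (has_mean_cst P (1 + b N w ^+ 2 + l N w ^+ 2)) hY)).
  + exact: measurable_phi.
  + by move=> w'; exact: phi_le.
- by move=> w; have [_] := phi_mean0 N (b N w) (l N w).
Qed.
End martingale.
End model.

(** * Decomposition of the area under the age curve *)

Section increments.
Context {R : realType} {n : nat} (k : nat) (len : 'I_n -> nat) (th e1 e2 a : R).

(** Idle time accumulated so far, if [x] is the time since the last served arrival and [z] the
    length of that codeword. *)
Definition excess (x z : R) : R := Num.max (x - z) 0.

Definition length_incr (f : 'I_n -> R) (c : R) (i : 'I_n) (x z y : R) : R :=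
  (accept k x z y i)%:R * (f i - c).
(** Over a service cycle with idle time [I] these increments add up to [I - th]. *)
Definition idle_incr (i : 'I_n) (x z y : R) : R :=
  excess (x + y) z - excess x z - th * (accept k x z y i)%:R.
(** Over such a cycle these add up to [I ^ 2 - 2 * th * I], centred when [I] is exponential of mean
    [th]. *)
Definition idle_sqr_incr (i : 'I_n) (x z y : R) : R :=
  excess (x + y) z ^+ 2 - excess x z ^+ 2 -
  2 * th * ((accept k x z y i)%:R * excess (x + y) z).

(* The coefficients are obtained by eliminating the number of served packets
   between the expressions of the area and of the elapsed time. *)
Definition reward_incr (i : 'I_n) (x z y : R) : R :=
  (th - a) * length_incr (fun i => (len i)%:R) e1 i x z y +
  2^-1 * length_incr (fun i => (len i)%:R ^+ 2) e2 i x z y +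
  (th - a) * idle_incr i x z y + z * idle_incr i x z y +
  2^-1 * idle_sqr_incr i x z y +
  (x + y) * length_incr (fun i => (len i)%:R) e1 i x z y.

(** A purely pathwise identity, checked one packet at a time. In the application [th] is the mean
    idle time, [e1] and [e2] are the moments of the codeword length, and [a + e1] is the claimed
    age; the condition on [a] balances the constants that each service contributes. *)
Lemma area_identity (y : nat -> R) (m : nat -> 'I_n) N :
  2 * (a * (e1 + th)) = e2 + 2 * th * e1 + 2 * th ^+ 2 ->
  let b := elapsed k len y m in let l := lastlen k len y m in
  area k len y m N = (a + e1) * ptime y N +
    \sum_(j < N) reward_incr (m j) (b j) (l j) (y j) - (a + e1) * b N +
    (a - th) * (l N + excess (b N) (l N)) - l N * excess (b N) (l N) -
    excess (b N) (l N) ^+ 2 / 2.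
Proof.
move=> aE b l; elim: N => [|N IH].
  rewrite /area /ptime !big_ord0 /b /l /elapsed /lastlen /= /excess subrr maxxx.
  by field.
rewrite /area big_ord_recr /= -/(area k len y m N) IH ptimeS big_ord_recr /=.
rewrite -/(b N) -/(l N) /b elapsedS /l lastlenS -/b -/l -/(b N) -/(l N).
rewrite /reward_incr /length_incr /idle_incr /idle_sqr_incr -/(accepted k len y m N).
case: ifPn => acc /=.
  (* Acceptance makes the idle time nonnegative, so the truncation is inactive; just after it the
     idle time is 0. *)
  have -> : excess (b N + y N) (l N) = b N + y N - l N.
    by rewrite /excess max_l // subr_ge0; case/andP: acc.
  have -> : excess 0 (len (m N))%:R = 0 by rewrite /excess max_r // sub0r oppr_le0.
  move: aE; set s := \sum_(j < N) _ => aE.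
  have {}aE : e2 = 2 * (a * (e1 + th)) - 2 * th * e1 - 2 * th ^+ 2 by rewrite aE; ring.
  by rewrite aE; field.
by field.
Qed.

Lemma norm_le1_sqr (u : R) : `|u| <= 1 + u ^+ 2.
Proof. by rewrite -[u ^+ 2]real_normK ?num_real //; have := normr_ge0 u; nra. Qed.

Let excess_lip (x z y : R) : `|excess (x + y) z - excess x z| <= `|y|.
Proof.
rewrite ler_norml /excess.
case: (leP (x + y - z) 0) => h1; case: (leP (x - z) 0) => h2;
  have h3 := ler_norm y; have := ler_norm (- y); rewrite normrN => h4;
  apply/andP; split; lra.
Qed.

Let excess_sqr_le (x z : R) : excess x z ^+ 2 <= 2 * (x ^+ 2 + z ^+ 2).
Proof.
rewrite /excess; case: (leP (x - z) 0) => _; last by have := sqr_ge0 (x + z); lra.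
by rewrite expr0n mulr_ge0 // addr_ge0 ?sqr_ge0.
Qed.

Lemma length_incr_le f c i x z y :
  `|length_incr f c i x z y| <= \sum_j `|f j| + `|c|.
Proof.
rewrite /length_incr normrM.
have -> : `|(accept k x z y i)%:R : R| = (accept k x z y i)%:R by rewrite ger0_norm.
apply: (@le_trans _ _ `|f i - c|).
  by case: (accept _ _ _ _ _); rewrite ?mul1r ?mul0r.
apply: (le_trans (ler_normB _ _)); rewrite lerD2r.
by rewrite (bigD1 i) //= lerDl sumr_ge0.
Qed.

Lemma idle_incr_le i x z y : `|idle_incr i x z y| <= `|y| + `|th|.
Proof.
apply: (le_trans (ler_normB _ _)); apply: lerD; first exact: excess_lip.
by rewrite normrM; case: (accept _ _ _ _ _); rewrite ?normr1 ?mulr1 ?normr0 ?mulr0.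
Qed.

Lemma idle_sqr_incr_le i x z y : `|idle_sqr_incr i x z y| <=
  (8 + 4 * `|th|) * (1 + x ^+ 2 + z ^+ 2 + y ^+ 2).
Proof.
have X1 := excess_sqr_le x z; have X2 := excess_sqr_le (x + y) z.
have xy := sqr_ge0 (x - y); have t0 := normr_ge0 th.
have X0 : 0 <= excess (x + y) z by rewrite /excess le_max lexx orbT.
apply: (le_trans (ler_normB _ _)).
have h1 : `|excess (x + y) z ^+ 2 - excess x z ^+ 2| <= 8 * (x ^+ 2 + z ^+ 2 + y ^+ 2).
  have s1 := sqr_ge0 (excess (x + y) z); have s2 := sqr_ge0 (excess x z).
  have s3 := sqr_ge0 z; have s4 := sqr_ge0 y.
  by rewrite ler_norml; apply/andP; split; lra.
have h2 : `|2 * th * ((accept k x z y i)%:R * excess (x + y) z)| <=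
    `|th| * (1 + excess (x + y) z ^+ 2).
  apply: (@le_trans _ _ (`|th| * (2 * excess (x + y) z))).
    case: (accept _ _ _ _ _); last by rewrite mul0r mulr0 normr0 !mulr_ge0.
    by rewrite mul1r !normrM (ger0_norm X0) [`|2|]ger0_norm // [2 * _]mulrC mulrA.
  by apply: ler_wpM2l => //; have := sqr_ge0 (excess (x + y) z - 1); nra.
apply: (le_trans (lerD h1 h2)).
have h3 : `|th| * (1 + excess (x + y) z ^+ 2) <= `|th| * (4 * (1 + x ^+ 2 + z ^+ 2 + y ^+ 2)).
  apply: ler_wpM2l => //; have := sqr_ge0 z; have := sqr_ge0 y; nra.
by apply: (le_trans (lerD (lexx _) h3)); lra.
Qed.
End increments.

(** * Mean-zero increments *)

Section centered.
Context {d : measure_display} {T : measurableType d} {R : realType} {n : nat}.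
Variables (P : probability T R) (p : 'I_n -> R) (k : nat).
Variables (lam : R) (Y : nat -> T -> R).
Hypotheses (lam0 : 0 < lam) (p1 : \sum_i p i = 1).
Hypothesis q0 : 0 < q_k k p.
Hypothesis mY : forall j, measurable_fun setT (Y j).
Hypothesis Y0 : forall j w, 0 <= Y j w.
Hypothesis expY : forall j, exponential_cdf P lam (Y j).

(** Exactly the conditions on [phi] in [martingale_strong_law], packaged to be stable under linear
    combinations. *)
Definition centered (phi : 'I_n -> R -> R -> R -> R) :=
  [/\ forall i, measurable_fun setT ((fun z => phi i z.1.1 z.1.2 z.2) : R * R * R -> R),
      exists K, forall i x z y, `|phi i x z y| <= K * (1 + x ^+ 2 + z ^+ 2 + y ^+ 2) &
      forall N x z, has_mean P (fun w => \sum_i p i * phi i x z (Y N w)) 0].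

Lemma centeredD phi psi : centered phi -> centered psi ->
  centered (fun i x z y => phi i x z y + psi i x z y).
Proof.
move=> [m1 [K1 b1] h1] [m2 [K2 b2] h2]; split.
- by move=> i; exact: measurable_funD.
- exists (K1 + K2) => i x z y; apply: (le_trans (ler_normD _ _)).
  by rewrite mulrDl lerD.
- move=> N x z; apply: (has_mean_ext (has_meanD (h1 N x z) (h2 N x z))); last by rewrite addr0.
  by move=> w; rewrite -big_split /=; apply: eq_bigr => i _; rewrite mulrDr.
Qed.

Lemma centeredZ c phi : centered phi -> centered (fun i x z y => c * phi i x z y).
Proof.
move=> [m1 [K1 b1] h1]; split.
- by move=> i; exact: measurable_funM.
- exists (`|c| * K1) => i x z y; rewrite normrM -mulrA ler_wpM2l //.
- move=> N x z; apply: (has_mean_ext (has_meanZ c (h1 N x z))); last by rewrite mulr0.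
  by move=> w; rewrite mulr_sumr; apply: eq_bigr => i _; rewrite mulrCA.
Qed.

Let fst_fst : measurable_fun setT (fun z : R * R * R => z.1.1).
Proof. exact: measurableT_comp measurable_fst measurable_fst. Qed.

Let snd_fst : measurable_fun setT (fun z : R * R * R => z.1.2).
Proof. exact: measurableT_comp measurable_snd measurable_fst. Qed.

Let snd3 : measurable_fun setT (fun z : R * R * R => z.2).
Proof. exact: measurable_snd. Qed.

Let measurable_accept (i : 'I_n) :
  measurable_fun setT (fun z : R * R * R => (accept k z.1.1 z.1.2 z.2 i)%:R : R).
Proof.
rewrite (_ : (fun z => _) = (fun z : R * R * R =>
    if accept k z.1.1 z.1.2 z.2 i then 1 else 0)); last first.
  by apply/funext => z; case: ifP.
apply: measurable_fun_ifT => //; apply: measurable_and => //.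
by apply: measurable_fun_ler => //; exact: measurable_funD.
Qed.

Let measurable_excess : measurable_fun setT (fun z : R * R * R => excess z.1.1 z.1.2).
Proof. by apply: measurable_maxr => //; exact: measurable_funB. Qed.

Let measurable_excessD :
  measurable_fun setT (fun z : R * R * R => excess (z.1.1 + z.2) z.1.2).
Proof. by apply: measurable_maxr => //; apply: measurable_funB => //; exact: measurable_funD. Qed.

Let acceptE (i : 'I_n) (x z y : R) : (accept k x z y i)%:R = (i < k)%N%:R * (z <= x + y)%R%:R :> R.
Proof. by rewrite /accept -natrM mulnb. Qed.

Let sum_indic : \sum_i p i * (i < k)%N%:R = q_k k p.
Proof.
rewrite /q_k [RHS]big_mkcond /=; apply: eq_bigr => i _.
by case: (i < k)%N; rewrite ?mulr1 ?mulr0.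
Qed.

(** The indicator of an idle transmitter does not involve the realization, so averaging over
    realizations alone already gives 0, for every [y]. Multiplying by a function of [x], [z] and [y]
    therefore preserves centring. *)
Lemma sum_length_incr f c x z y : \sum_i p i * ((i < k)%N%:R * f i) = q_k k p * c ->
  \sum_i p i * length_incr k f c i x z y = 0.
Proof.
move=> fc; transitivity ((z <= x + y)%R%:R * (\sum_i p i * ((i < k)%N%:R * f i) -
    c * \sum_i p i * (i < k)%N%:R)).
  rewrite mulr_sumr -sumrB mulr_sumr; apply: eq_bigr => i _.
  by rewrite /length_incr acceptE; ring.
by rewrite fc sum_indic [c * _]mulrC subrr mulr0.
Qed.

Lemma centered_length f c : \sum_i p i * ((i < k)%N%:R * f i) = q_k k p * c ->
  centered (length_incr k f c).
Proof.
move=> fc; split.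
- by move=> i; exact: measurable_funM.
- exists (\sum_j `|f j| + `|c|) => i x z y; apply: (le_trans (length_incr_le _ _ _ _ _ _ _)).
  rewrite ler_peMr ?addr_ge0 ?sumr_ge0 // -!addrA lerDl !addr_ge0 ?sqr_ge0 //.
- move=> N x z; apply: (has_mean_ext (has_mean_cst P 0)) => // w.
  by rewrite sum_length_incr.
Qed.

Lemma centered_sojourn_length f c : \sum_i p i * ((i < k)%N%:R * f i) = q_k k p * c ->
  centered (fun i x z y => (x + y) * length_incr k f c i x z y).
Proof.
move=> fc; split.
- move=> i; apply: measurable_funM; first exact: measurable_funD.
  exact: measurable_funM.
- exists (2 * (\sum_j `|f j| + `|c|)) => i x z y; rewrite normrM mulrC [2 * _]mulrC -mulrA.
  apply: ler_pM => //; first exact: length_incr_le.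
  apply: (le_trans (norm_le1_sqr _)).
  by have := sqr_ge0 (x - y); have := sqr_ge0 z; lra.
- move=> N x z; apply: (has_mean_ext (has_mean_cst P 0)) => // w.
  transitivity ((x + Y N w) * \sum_i p i * length_incr k f c i x z (Y N w)).
    by rewrite sum_length_incr // mulr0.
  by rewrite mulr_sumr; apply: eq_bigr => i _; rewrite mulrCA.
Qed.

(** Mean idle time: encoded packets form a thinned Poisson process of rate [q_k k p * lam]. *)
Let th := 1 / (q_k k p * lam).

Let th_q : th * q_k k p = lam^-1.
Proof. by rewrite /th; field; rewrite !gt_eqF. Qed.

Lemma idle_incr_mean0 N x z :
  has_mean P (fun w => \sum_i p i * idle_incr k th i x z (Y N w)) 0.
Proof.
apply: (has_mean_ext (excess_mean0 P lam (Y N) lam0 (mY N) (Y0 N) (expY N) (x - z))) => // w.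
transitivity (excess (x + Y N w) z * \sum_i p i - excess x z * \sum_i p i -
   th * \sum_i p i * (i < k)%N%:R * (z <= x + Y N w)%R%:R).
  have -> : x - z + Y N w = x + Y N w - z by ring.
  by rewrite p1 !mulr1 -mulr_suml sum_indic mulrA th_q /excess subr_ge0.
rewrite !mulr_sumr -!sumrB; apply: eq_bigr => i _.
by rewrite /idle_incr acceptE; ring.
Qed.

Lemma centered_idle : centered (idle_incr k th).
Proof.
split.
- move=> i; apply: measurable_funB; last exact: measurable_funM.
  exact: measurable_funB.
- exists (1 + `|th|) => i x z y; apply: (le_trans (idle_incr_le _ _ _ _ _ _)).
  have := norm_le1_sqr y; have := normr_ge0 th.
  by have := sqr_ge0 x; have := sqr_ge0 z; have := sqr_ge0 y; nra.
- exact: idle_incr_mean0.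
Qed.

Lemma centered_length_idle : centered (fun i x z y => z * idle_incr k th i x z y).
Proof.
split.
- move=> i; apply: measurable_funM => //; apply: measurable_funB; last exact: measurable_funM.
  exact: measurable_funB.
- exists (1 + `|th|) => i x z y; rewrite normrM.
  apply: (@le_trans _ _ (`|z| * (`|y| + `|th|))); first by rewrite ler_wpM2l // idle_incr_le.
  have := norm_le1_sqr z; have t0 := normr_ge0 th; have := sqr_ge0 (`|z| - `|y|).
  have := sqr_ge0 x; have := sqr_ge0 y; have := sqr_ge0 z.
  rewrite -[y ^+ 2]real_normK ?num_real // -[z ^+ 2]real_normK ?num_real //.
  by nra.
- move=> N x z; apply: (has_mean_ext (has_meanZ z (idle_incr_mean0 N x z))); last by rewrite mulr0.
  by move=> w; rewrite mulr_sumr; apply: eq_bigr => i _; rewrite mulrCA.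
Qed.

Lemma centered_idle_sqr : centered (idle_sqr_incr k th).
Proof.
split.
- move=> i; apply: measurable_funB.
    by apply: measurable_funB; exact: measurable_funX.
  by apply: measurable_funM => //; exact: measurable_funM.
- by exists (8 + 4 * `|th|) => i x z y; exact: idle_sqr_incr_le.
- move=> N x z.
  apply: (has_mean_ext (excess_sqr_mean0 P lam (Y N) lam0 (mY N) (Y0 N) (expY N) (x - z))) => // w.
  transitivity (excess (x + Y N w) z ^+ 2 * \sum_i p i - excess x z ^+ 2 * \sum_i p i -
    2 * th * \sum_i p i * (i < k)%N%:R * ((z <= x + Y N w)%R%:R * excess (x + Y N w) z)).
    have -> : x - z + Y N w = x + Y N w - z by ring.
    have F (u : R) : 2 * th * (q_k k p * u) = 2 * lam^-1 * u by rewrite -th_q; ring.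
    rewrite p1 !mulr1 -mulr_suml sum_indic F /excess.
    (* The indicator can be absorbed, since the excess vanishes wherever the indicator does. *)
    congr (_ - 2 * _ * _); rewrite -[z <= _]subr_ge0.
    by case: (leP 0 (x + Y N w - z)) => h; rewrite ?mul1r ?mul0r.
  rewrite !mulr_sumr -!sumrB; apply: eq_bigr => i _.
  by rewrite /idle_sqr_incr acceptE; ring.
Qed.

Lemma centered_reward (len : 'I_n -> nat) (a : R) :
  centered (reward_incr k len th (EL k p len) (EL2 k p len) a).
Proof.
(* Passes from sums weighted by [p] to expectations under the conditional pmf, at the cost of a
   factor [q_k k p]. *)
have E (f : 'I_n -> R) : \sum_i p i * ((i < k)%N%:R * f i) =
    q_k k p * \sum_(i < n | (i < k)%N) pmf_k k p i * f i.
  rewrite [in RHS]big_mkcond mulr_sumr; apply: eq_bigr => i _.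
  rewrite /pmf_k; case: (i < k)%N; last by rewrite mul0r !mulr0.
  by rewrite mul1r; field; rewrite gt_eqF.
have h1 := E (fun i => (len i)%:R); have h2 := E (fun i => (len i)%:R ^+ 2).
apply: centeredD; last exact: centered_sojourn_length.
apply: centeredD; last exact/centeredZ/centered_idle_sqr.
apply: centeredD; last exact: centered_length_idle.
apply: centeredD; last exact/centeredZ/centered_idle.
by apply: centeredD; apply: centeredZ; exact: centered_length.
Qed.

(** Yields the law of large numbers for arrival times from the same martingale law. *)
Lemma centered_interarrival : centered (fun i x z y => y - lam^-1).
Proof.
split.
- by move=> i; exact: measurable_funB.
- exists (1 + `|lam^-1|) => i x z y; apply: (le_trans (ler_normB _ _)).
  have := norm_le1_sqr y; have := normr_ge0 lam^-1.
  by have := sqr_ge0 x; have := sqr_ge0 z; have := sqr_ge0 y; nra.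
- move=> N x z.
  apply: (has_mean_ext (has_meanB (exponential_pow_mean P lam (Y N) lam0 (mY N) (Y0 N) (expY N) 0)
    (has_mean_cst P lam^-1))).
    by move=> w; rewrite -mulr_suml p1 mul1r expr1.
  by rewrite (_ : 1`! = 1%N) // expr1 mul1r subrr.
Qed.
End centered.

(** * Almost sure convergence of the average age *)

Lemma dominated_by_sqr_cvg0 {R : realType} (b f : nat -> R) (c : R) :
  (b N ^+ 2 / N.+1%:R) @[N --> \oo] --> (0 : R) ->
  (forall N, `|f N| <= c * (1 + b N ^+ 2)) ->
  (f N / N%:R) @[N --> \oo] --> (0 : R).
Proof.
move=> cb fb.
have cu : (c * ((N.+1%:R)^-1 + b N ^+ 2 / N.+1%:R) * (N.+1%:R / N%:R)) @[N --> \oo] --> (0 : R).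
  have -> : (0 : R) = c * (0 + 0) * 1 by rewrite addr0 mulr0 mul0r.
  apply: cvgM; last exact: cvg_harmonic_ratio.
  apply: cvgM; first exact: cvg_cst.
  by apply: cvgD => //; exact: cvg_harmonic.
apply: norm_cvg0; apply: (squeeze_cvgr _ (cvg_cst 0) cu).
near=> N; rewrite normr_ge0 /=.
have N0 : N%:R != 0 :> R by rewrite pnatr_eq0 -lt0n; near: N; exact: nbhs_infty_gt.
have N1 : N.+1%:R != 0 :> R by rewrite pnatr_eq0.
rewrite normrM normfV [`|N%:R|]ger0_norm //.
have -> (u v s : R) : v != 0 -> s != 0 -> c * (v^-1 + u / v) * (v / s) = c * (1 + u) / s.
  by move=> v0 s0; field; rewrite v0 s0.
all: rewrite ?ler_wpM2r ?invr_ge0 //.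
Unshelve. all: by end_near. Qed.

(** Three almost sure limits suffice for the pathwise lemmas: the averaged reward increments, the
    averaged centred interarrivals, and the vanishing of the squared elapsed time over the number of
    packets. *)
Lemma average_age_nonneg_interarrivals {R : realType} {d : measure_display}
    {T : measurableType d} (P : probability T R) {n : nat} (p : 'I_n -> R) (k : nat)
    (len : 'I_n -> nat) (lam : R) (Y : nat -> T -> R) (M : nat -> T -> 'I_n) :
  (forall i, 0 <= p i) -> \sum_i p i = 1 -> 0 < q_k k p -> 0 < lam ->
  (forall j, measurable_fun setT (Y j)) ->
  (forall j i, measurable [set w | M j w = i]) ->
  (forall j w, 0 <= Y j w) ->
  (forall j, exponential_cdf P lam (Y j)) ->
  (forall j i, P [set w | M j w = i] = (p i)%:E) ->
  mutually_independent P Y M ->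
  {ae P, forall w,
    (fun t : R => ((t^-1)%:E * \int[lebesgue_measure]_(u in `[0%R, t])
       (age k len (arrival Y w) (fun j => M j w) u)%:E)%E)
    @ +oo --> (age_formula k p len lam)%:E}.
Proof.
move=> p0 p1 q0 lam0 mY mM Y0 expY PM indep.
pose th := 1 / (q_k k p * lam); pose e1 := EL k p len; pose e2 := EL2 k p len.
pose a := (e2 + 2 * th * e1 + 2 * th ^+ 2) / (2 * (e1 + th)).
have th0 : 0 < th by rewrite divr_gt0 // mulr_gt0.
have e10 : 0 <= e1.
  by apply: sumr_ge0 => i ik; rewrite mulr_ge0 // /pmf_k ik divr_ge0 // ltW.
have aE : 2 * (a * (e1 + th)) = e2 + 2 * th * e1 + 2 * th ^+ 2.
  by rewrite /a; field; rewrite gt_eqF // ltr_wpDl.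
have DeltaE : age_formula k p len lam = a + e1.
  have t1 : 2 / (q_k k p * lam) = 2 * th by rewrite /th mul1r.
  have t2 : 2 / (q_k k p * lam) ^+ 2 = 2 * th ^+ 2 by rewrite /th expr_div_n expr1n mul1r.
  by rewrite /age_formula /a t1 t2.
have [m1 [K1 b1] h1] := centered_reward P p k lam Y lam0 p1 q0 mY Y0 expY len a.
have [m2 [K2 b2] h2] := centered_interarrival P p lam Y lam0 p1 mY Y0 expY.
have law := martingale_strong_law P p k len lam Y M lam0 p0 p1 q0 mY mM Y0 expY PM indep.
have law1 := law _ K1 m1 b1 h1.
have law2 := law _ K2 m2 b2 h2.
have law3 := elapsed_sqr_cvg0 P p k len lam Y M lam0 p0 p1 q0 mY mM Y0 expY PM indep.
move: law1 law2 law3; apply: filterS3 => w law1 law2 law3.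
pose L : R := \sum_i (len i)%:R.
set y := Y^~ w in law1 law2 law3 *; set m := M^~ w in law1 law2 law3 *.
have y0 j : 0 <= y j by exact: Y0.
pose b := elapsed k len y m; pose l := lastlen k len y m.
have b0 N : 0 <= b N by exact: elapsed_ge0.
have bb N : b N <= 1 + b N ^+ 2.
  by have := sqr_ge0 (b N - 1); have := b0 N; nra.
have cS : (ptime y j / j%:R) @[j --> \oo] --> lam^-1.
  have h : ((\sum_(j < N) (y j - lam^-1)) / N%:R + lam^-1) @[N --> \oo] --> lam^-1.
    by rewrite -[X in _ --> X]add0r; apply: cvgD => //; exact: cvg_cst.
  apply: cvg_trans h; apply: near_eq_cvg; near=> N.
  have N0 : N%:R != 0 :> R by rewrite pnatr_eq0 -lt0n; near: N; exact: nbhs_infty_gt.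
  rewrite sumrB sumr_const card_ord -/(ptime y N) -[lam^-1 *+ N]mulr_natr.
  by field; rewrite N0 gt_eqF.
have cb : (b N / N%:R) @[N --> \oo] --> (0 : R).
  apply: (dominated_by_sqr_cvg0 b _ 1) => // N.
  by rewrite mul1r ger0_norm.
rewrite DeltaE; apply: (average_age_cvg k len y m lam) => //.
(* The boundary term of [area_identity]; it is at most a constant times [1 + b N ^ 2], because [l]
   is bounded by [L] and the excess by [b]. *)
pose rem N := - (a + e1) * b N + (a - th) * (l N + excess (b N) (l N)) -
  l N * excess (b N) (l N) - excess (b N) (l N) ^+ 2 / 2.
have rem_le (X u v : R) : 0 <= u -> u <= 1 + u ^+ 2 -> 0 <= v -> v <= L -> 0 <= X -> X <= u ->
    `|- (a + e1) * u + (a - th) * (v + X) - v * X - X ^+ 2 / 2| <=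
    (`|a + e1| + `|a - th| * (L + 1) + L + 1) * (1 + u ^+ 2).
  move=> u0 uu v0 vL X0 Xu.
  have s1 : `|- (a + e1) * u| <= `|a + e1| * (1 + u ^+ 2).
    by rewrite normrM normrN ler_wpM2l // ger0_norm.
  have s2 : `|(a - th) * (v + X)| <= `|a - th| * ((L + 1) * (1 + u ^+ 2)).
    by rewrite normrM ler_wpM2l // ger0_norm ?addr_ge0 //; have := sqr_ge0 u; nra.
  have s3 : `|v * X| <= L * (1 + u ^+ 2).
    rewrite ger0_norm ?mulr_ge0 //; apply: ler_pM => //; exact: le_trans uu.
  have s4 : `|X ^+ 2 / 2| <= 1 + u ^+ 2.
    rewrite ger0_norm ?divr_ge0 ?sqr_ge0 //.
    have : X ^+ 2 <= u ^+ 2 by rewrite lerXn2r ?nnegrE.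
    by have := sqr_ge0 X; lra.
  have -> (A B Q : R) : (A + B * (L + 1) + L + 1) * Q =
      A * Q + B * ((L + 1) * Q) + L * Q + Q by ring.
  apply: (le_trans (ler_normB _ _)); apply: lerD => //.
  apply: (le_trans (ler_normB _ _)); apply: lerD => //.
  by apply: (le_trans (ler_normD _ _)); apply: lerD.
have crem : (rem N / N%:R) @[N --> \oo] --> (0 : R).
  apply: (dominated_by_sqr_cvg0 b _ (`|a + e1| + `|a - th| * (L + 1) + L + 1)) => // N.
  have l0 : 0 <= l N by exact: lastlen_ge0.
  have lL : l N <= L by exact: lastlen_le.
  have X0 : 0 <= excess (b N) (l N) by rewrite /excess le_max lexx orbT.
  have Xb : excess (b N) (l N) <= b N by rewrite /excess ge_max b0 andbT gerBl.
  exact: rem_le.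
have h : ((a + e1) * (ptime y N / N%:R) +
    (\sum_(j < N) reward_incr k len th e1 e2 a (m j) (b j) (l j) (y j)) / N%:R +
    rem N / N%:R) @[N --> \oo] --> (a + e1) / lam.
  rewrite -[X in _ --> X]addr0; apply: cvgD => //.
  rewrite -[X in _ --> X]addr0; apply: cvgD => //.
  by apply: cvgM => //; exact: cvg_cst.
apply: cvg_trans h; apply: near_eq_cvg; near=> N.
rewrite (area_identity k len th e1 e2 a y m N aE) /rem -/b -/l.
have N0 : N%:R != 0 :> R by rewrite pnatr_eq0 -lt0n; near: N; exact: nbhs_infty_gt.
by field.
Unshelve. all: by end_near. Qed.

Theorem theorem1 (R : realType) (d : measure_display) (Omega : measurableType d)
    (P : probability Omega R)
    (n : nat) (p : 'I_n -> R) (k : nat) (len : 'I_n -> nat) (lam : R)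
    (Y : nat -> Omega -> R) (M : nat -> Omega -> 'I_n) :
  (forall i, 0 <= p i) ->
  \sum_(i < n) p i = 1 ->
  (forall i j : 'I_n, (i <= j)%N -> p j <= p i) ->
  (0 < k <= n)%N ->
  0 < lam ->
  (forall j, measurable_fun setT (Y j)) ->
  (forall j (i : 'I_n), measurable [set w | M j w = i]) ->
  (forall j, exponential_cdf P lam (Y j)) ->
  (forall j (i : 'I_n), P [set w | M j w = i] = (p i)%:E) ->
  mutually_independent P Y M ->
  {ae P, forall w,
    (fun T : R => ((T^-1)%:E *
       \int[lebesgue_measure]_(t in `[0%R, T]) (age k len (arrival Y w) (fun j => M j w) t)%:E)%E)
    @ +oo --> (age_formula k p len lam)%:E}.
Proof.
move=> p0 p1 pmon /andP[k0 kn] lam0 mY mM expY PM indep.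
(* The first realization is the most likely one; were its probability 0, all would be, against total
   mass 1. *)
have q0 : 0 < q_k k p.
  pose i : 'I_n := Ordinal (leq_trans k0 kn).
  have pi0 : 0 < p i.
    rewrite lt_neqAle p0 andbT eq_sym; apply: contra_eq_neq p1 => pi.
    rewrite big1 1?eq_sym ?oner_eq0 // => j _; apply/eqP; rewrite eq_le p0 andbT -pi.
    exact: pmon.
  by rewrite /q_k (bigD1 i) //= ltr_pwDl // sumr_ge0.
(* Interarrival times are nonnegative only almost surely. Truncation at 0 makes them so everywhere
   and keeps the laws and the independence. *)
pose Y' j w := Num.max (Y j w) 0.
have mmax : measurable_fun setT (fun y : R => Num.max y 0) by exact: measurable_maxr.
have mY' j : measurable_fun setT (Y' j) by exact: measurable_maxr.
have Y'0 j w : 0 <= Y' j w by rewrite le_max lexx orbT.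
have expY' j : exponential_cdf P lam (Y' j).
  move=> y; rewrite -(expY j y); have [y0|y0] := leP 0 y.
    by congr (P _); apply/seteqP; split=> w /=; rewrite ge_max y0 andbT.
  rewrite expY y0 (_ : [set w | _] = set0) ?measure0 //.
  by apply/seteqP; split=> w //=; rewrite ge_max [0 <= y]leNgt y0 andbF.
have indep' : mutually_independent P Y' M.
  move=> N A B mA; pose A' j := (fun y : R => Num.max y 0) @^-1` A j.
  have mA' j : measurable (A' j) by rewrite -[A' j]setTI; exact: mmax.
  exact: (indep N A' B mA').
have main := average_age_nonneg_interarrivals P p k len lam Y' M p0 p1 q0 lam0
  mY' mM Y'0 expY' PM indep'.
have Yge0 : {ae P, forall w, forall j, 0 <= Y j w}.
  apply: ae_foralln => j; exists [set w | Y j w <= 0]; split.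
  - by rewrite -[X in measurable X]setTI; exact: measurable_fun_le.
  - by have := expY j 0; rewrite ltxx mulr0 oppr0 expR0 subrr.
  - by move=> w /= /negP; rewrite -ltNge => /ltW.
move: main Yge0; apply: filterS2 => w + Yw.
rewrite (_ : arrival Y' w = arrival Y w) //; apply/funext => j.
by apply: eq_bigr => i _; rewrite /Y' max_l.
Qed.
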